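(* Let $u(x,t)$ be a real-valued solution of the 2d incompressible Euler equation on $\mathbf{T}^2$, on some time interval $(t_1,t_2)$, which is supported on finitely many Fourier modes, i.e. there is a finite set $S\subset\mathbf{Z}^2$ such that $\hat u(k,t)=0$ for all $k\notin S$ and all $t\in(t_1,t_2)$. Then $u$ is independent of time. Moreover, its Fourier support is either a subset of a circle centered at the origin, or a subset of a line passing through the origin.
   Context: $\mathbf{T}^2=\mathbf{R}^2/2\pi\mathbf{Z}^2$. The incompressible Euler equation is $u_t+u\cdot\nabla u+\nabla p=0$, $\operatorname{div}u=0$, for a suitable pressure function $p$. Fourier series: $u(x,t)=\frac1{(2\pi)^2}\sum_{k\in\mathbf{Z}^2}\hat u(k,t)e^{ik\cdot x}$. The Fourier support of a function (or vector field) $f$ on $\mathbf{T}^2$ is the set $\{k\in\mathbf{Z}^2:\hat f(k)\neq0\}$.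
   Formalization: The formal theorem assumes in addition that u has zero mean, û(0,t)=0 for all t in (t1,t2); without this the claim is false, e.g. u=(1, cos(x1−t)) with p=0 is a time-dependent solution with finitely many modes. *)

(* Defs.v *)
From Stdlib Require Import Reals ZArith List.
From Coquelicot Require Import Coquelicot.
Open Scope R_scope.

(** A function on the torus T^2 = R^2 / 2 pi Z^2 is a function on the plane that
    is 2 pi-periodic in each coordinate. *)
Definition on_torus {V : Type} (f : R * R -> V) : Prop :=
  forall x1 x2 : R,
    f (x1 + 2 * PI, x2) = f (x1, x2) /\ f (x1, x2 + 2 * PI) = f (x1, x2).

Definition partial1 (f : R * R -> R) (x : R * R) : R :=
  Derive (fun s => f (s, snd x)) (fst x).

Definition partial2 (f : R * R -> R) (x : R * R) : R :=
  Derive (fun s => f (fst x, s)) (snd x).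

Definition divergence (v : R * R -> R * R) (x : R * R) : R :=
  partial1 (fun y => fst (v y)) x + partial2 (fun y => snd (v y)) x.

(** The derivative [(v . grad) f]. *)
Definition advect (v : R * R -> R * R) (f : R * R -> R) (x : R * R) : R :=
  fst (v x) * partial1 f x + snd (v x) * partial2 f x.

Definition in_interval (t1 t2 : Rbar) (t : R) : Prop :=
  Rbar_lt t1 t /\ Rbar_lt t t2.

(** Classical solutions, with only the regularity that makes the equation
    meaningful at each point: no continuity of the derivatives is required, and
    none at all of the pressure in [t].  The pressure is a function on the torus:
    for a pressure that is merely a function on the plane, [u = (f t, 0)] with
    [p = - f' t * x1] would also be a solution. *)
Definition euler_solution_with_pressure (t1 t2 : Rbar)
    (u : R * R -> R -> R * R) (p : R * R -> R -> R) : Prop :=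
  forall t : R, in_interval t1 t2 t ->
    on_torus (fun x => u x t) /\
    on_torus (fun x => p x t) /\
    forall x : R * R,
      ex_filterdiff (K := R_AbsRing) (fun y : R * R => u y t) (locally x) /\
      ex_derive (K := R_AbsRing) (fun s : R => u x s) t /\
      ex_filterdiff (K := R_AbsRing) (fun y : R * R => p y t) (locally x) /\
      Derive (fun s => fst (u x s)) t
        + advect (fun y => u y t) (fun y => fst (u y t)) x
        + partial1 (fun y => p y t) x = 0 /\
      Derive (fun s => snd (u x s)) t
        + advect (fun y => u y t) (fun y => snd (u y t)) x
        + partial2 (fun y => p y t) x = 0 /\
      divergence (fun y => u y t) x = 0.

Definition euler_solution (t1 t2 : Rbar) (u : R * R -> R -> R * R) : Prop :=
  exists p : R * R -> R -> R, euler_solution_with_pressure t1 t2 u p.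

(** [e^{i theta}] *)
Definition expi (theta : R) : C := (cos theta, sin theta).

Definition dotZ (k : Z * Z) (x : R * R) : R :=
  IZR (fst k) * fst x + IZR (snd k) * snd x.

(** [hat f (k)], the integral of [f x * e^{- i k . x}] over T^2.  There is no factor
    [1 / (2 pi)^2]: it stands in front of the Fourier series instead. *)
Definition fourier (f : R * R -> R) (k : Z * Z) : C :=
  RInt (V := C_R_CompleteNormedModule)
    (fun x1 => RInt (V := C_R_CompleteNormedModule)
       (fun x2 => Cmult (RtoC (f (x1, x2))) (expi (- dotZ k (x1, x2))))
       0 (2 * PI))
    0 (2 * PI).

Definition fourier_vec (v : R * R -> R * R) (k : Z * Z) : C * C :=
  (fourier (fun x => fst (v x)) k, fourier (fun x => snd (v x)) k).

Definition fourier_support (v : R * R -> R * R) (k : Z * Z) : Prop :=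
  fourier_vec v k <> (RtoC 0, RtoC 0).

Definition on_circle (r : R) (k : Z * Z) : Prop :=
  IZR (fst k) ^ 2 + IZR (snd k) ^ 2 = r ^ 2.

Definition on_line (a b : R) (k : Z * Z) : Prop :=
  a * IZR (fst k) + b * IZR (snd k) = 0.

(* Main.v *)
Require Import Defs.
From Stdlib Require Import Lra Lia Classical ClassicalEpsilon FinFun.
From Stdlib Require Import Reals ZArith List.
From Coquelicot Require Import Coquelicot.
Open Scope R_scope.

(** At each time the velocity is a trigonometric polynomial, with modes
    [a_k k^perp] since it is divergence-free, and each coefficient is a finite linear
    combination of values of [u], hence differentiable in time.  The curl of the
    equation (the pressure gradient is smooth, so Schwarz's theorem applies to the
    pressure) reads
      [2 |K|^2 a_K' = - i sum_{l + m = K} det(l, m) (|m|^2 - |l|^2) a_l a_m].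
    At a time where the support [A] of [a] is maximal, [A] is locally constant in
    time, so the right-hand side vanishes for [K] outside [A].  Hence whenever [l + m]
    lies outside [A] and is a sum of two elements of [A] in only one way, [l] and [m]
    are parallel or of the same length.  An extremality argument then puts [A] on a
    line through the origin or on a circle; in both cases every interaction vanishes,
    so [a] is locally constant, and a connectedness argument makes it constant. *)

(** * Rigidity of the support *)

(** Mode 0 needs separate care. The curl of the equation says nothing at $K = 0$, and with a mean $U
    \neq 0$ the Galilean translates $U + v(x - tU)$ of a stationary flow $v$ also solve the equation
    with finitely many modes, though they may depend on time. The zero-mean hypothesis excludes
    them, and it is what lets [a] describe the whole velocity. The hypothesis on [S] concerns
    integrals, while the equation holds pointwise. Uniqueness of Fourier coefficients for continuous
    functions bridges the two; afterwards coefficients are compared through values at finitely many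
    points, never by differentiating an integral. In the extremality argument, sums leave the
    support because of their length: if $x$ lies on the outermost circle $|x|^2 = N$ and $x \cdot y
    \ge 0$ with $y \neq 0$, then $|x + y|^2 > N$. Since the velocity is real, the support is
    symmetric, so the sign of an inner product can always be chosen. *)

Definition kadd (k l : Z * Z) : Z * Z := (fst k + fst l, snd k + snd l)%Z.
Definition kopp (k : Z * Z) : Z * Z := (- fst k, - snd k)%Z.
Definition kdot (k l : Z * Z) : Z := (fst k * fst l + snd k * snd l)%Z.
Definition kdet (k l : Z * Z) : Z := (fst k * snd l - snd k * fst l)%Z.

Lemma exists_maximizer {T : Type} (f : T -> Z) (l : list T) (P : T -> Prop) :
  (forall x, P x -> In x l) -> (exists x, P x) ->
  exists m, P m /\ forall x, P x -> (f x <= f m)%Z.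
Proof.
revert P; induction l as [|y l IH]; intros P Hl [x Px].
- destruct (Hl x Px).
- destruct (classic (exists z, P z /\ z <> y)) as [[z [Pz Hz]]|Hn].
  + destruct (IH (fun z => P z /\ z <> y)) as [m [[Pm _] Hm]].
    { intros w [Pw Hw]. destruct (Hl w Pw); [congruence|easy]. }
    { now exists z. }
    destruct (classic (P y /\ (f m < f y)%Z)) as [[Py Hy]|Hy].
    * exists y; split; [easy|]. intros w Pw.
      destruct (classic (w = y)) as [->|Hw]; [lia|].
      specialize (Hm w (conj Pw Hw)); lia.
    * exists m; split; [easy|]. intros w Pw.
      destruct (classic (w = y)) as [->|Hw]; [|now apply Hm].
      destruct (Z.lt_ge_cases (f m) (f y)); [now destruct Hy|lia].
  + exists x; split; [easy|]. intros w Pw.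
    assert (w = y) by (apply NNPP; intro; apply Hn; now exists w).
    assert (x = y) by (apply NNPP; intro; apply Hn; now exists x).
    subst; lia.
Qed.

(** [kdot a] and [kdet a] are coordinates in the orthogonal basis $a, a^\perp$, up to the factor
    $|a|^2$. With $x = y$ this is Cauchy-Schwarz over the integers, including its equality case. *)
Lemma kdet_kdot_identity (a x y : Z * Z) :
  (kdot a a * kdot x y = kdot a x * kdot a y + kdet a x * kdet a y)%Z.
Proof. unfold kdot, kdet; ring. Qed.

Lemma kdot_pos (a : Z * Z) : a <> (0, 0)%Z -> (0 < kdot a a)%Z.
Proof.
destruct a as [x y]; unfold kdot; simpl; intros H.
destruct (Z.eq_dec x 0) as [->|]; destruct (Z.eq_dec y 0) as [->|]; try nia.
now destruct H.
Qed.

Lemma kdot_kdet_inj (a x y : Z * Z) :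
  a <> (0, 0)%Z -> kdot a x = kdot a y -> kdet a x = kdet a y -> x = y.
Proof.
intros Ha H1 H2. apply kdot_pos in Ha.
destruct a as [a1 a2], x as [x1 x2], y as [y1 y2].
unfold kdot, kdet in *; simpl in *.
assert (F1 : ((a1*a1+a2*a2) * x1 = (a1*a1+a2*a2) * y1)%Z).
{ replace ((a1*a1+a2*a2) * x1)%Z with (a1*(a1*x1+a2*x2) - a2*(a1*x2-a2*x1))%Z by ring.
  rewrite H1, H2; ring. }
assert (F2 : ((a1*a1+a2*a2) * x2 = (a1*a1+a2*a2) * y2)%Z).
{ replace ((a1*a1+a2*a2) * x2)%Z with (a2*(a1*x1+a2*x2) + a1*(a1*x2-a2*x1))%Z by ring.
  rewrite H1, H2; ring. }
f_equal; [apply Z.mul_reg_l in F1|apply Z.mul_reg_l in F2]; lia.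
Qed.

(* The pairs (a, b), (a, d), (b, d) below are extremal for the functional [kdot a],
   which is what makes them isolated. *)
Lemma support_rigidity (A : Z * Z -> Prop) (L : list (Z * Z))
  (finA : forall k, A k -> In k L)
  (symA : forall k, A k -> A (kopp k))
  (A0 : ~ A (0, 0)%Z)
  (isolated_pair : forall a b, A a -> A b -> ~ A (kadd a b) ->
    (forall c d, A c -> A d -> kadd c d = kadd a b ->
       kdet c d = 0%Z \/ kdot c c = kdot d d \/ c = a \/ c = b) ->
    kdet a b = 0%Z \/ kdot a a = kdot b b) :
  (exists a, a <> (0, 0)%Z /\ forall k, A k -> kdet a k = 0%Z) \/
  (exists N, (0 < N)%Z /\ forall k, A k -> kdot k k = N).
Proof.
destruct (classic (exists k, A k)) as [Ex|Nex].
2:{ left; exists (1, 0)%Z; split; [easy|]. intros k Ak; destruct Nex; now exists k. }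
destruct (exists_maximizer (fun k => kdot k k) L A finA Ex) as [c [Ac Hc]].
set (N := kdot c c) in *.
destruct (classic (exists k, A k /\ kdot k k <> N)) as [[b0 [Ab0 Hb0]]|NB].
2:{ right; exists N; split.
    - apply kdot_pos; intros ->; easy.
    - intros k Ak; apply NNPP; intro; apply NB; now exists k. }
left.
assert (nz : forall k, A k -> k <> (0, 0)%Z) by (intros k Ak ->; easy).
assert (pos : forall k, A k -> (0 < kdot k k)%Z) by (intros; now apply kdot_pos, nz).
destruct (exists_maximizer (fun p => kdot (fst p) (snd p)) (list_prod L L)
  (fun p => A (fst p) /\ A (snd p) /\ kdot (fst p) (fst p) = N /\
            kdot (snd p) (snd p) <> N)) as [[a b] [H Hab]].
{ intros [x y]; simpl; intros H; apply in_prod; now apply finA. }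
{ now exists (c, b0). }
simpl in H; destruct H as [Aa [Ab [Na Nb]]].
assert (max_ab : forall x y, A x -> A y -> kdot x x = N -> kdot y y <> N ->
   (kdot x y <= kdot a b)%Z).
{ intros x y ? ? ? ?; now apply (Hab (x, y)). }
clear Hab.
assert (kopp_dot : forall x y, kdot x (kopp y) = (- kdot x y)%Z)
  by (intros; unfold kdot, kopp; cbn [fst snd]; ring).
assert (kopp_sq : forall y, kdot (kopp y) (kopp y) = kdot y y)
  by (intros; unfold kdot, kopp; cbn [fst snd]; ring).
assert (kopp_det : forall x y, kdet x (kopp y) = (- kdet x y)%Z)
  by (intros; unfold kdet, kopp; cbn [fst snd]; ring).
assert (ab0 : (0 <= kdot a b)%Z).
{ specialize (max_ab a (kopp b) Aa (symA b Ab) Na); rewrite kopp_sq, kopp_dot in max_ab.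
  specialize (max_ab Nb); lia. }
assert (dotD : forall x y z, kdot x (kadd y z) = (kdot x y + kdot x z)%Z)
  by (intros; unfold kdot, kadd; cbn [fst snd]; ring).
assert (detD : forall x y z, kdet x (kadd y z) = (kdet x y + kdet x z)%Z)
  by (intros; unfold kdet, kadd; cbn [fst snd]; ring).
assert (sqD : forall y z, kdot (kadd y z) (kadd y z) = (kdot y y + 2 * kdot y z + kdot z z)%Z)
  by (intros; unfold kdot, kadd; cbn [fst snd]; ring).
assert (out : forall x y, A x -> A y -> kdot x x = N -> (0 <= kdot x y)%Z -> ~ A (kadd x y)).
{ intros x y Ax Ay Nx xy0 Axy. specialize (Hc _ Axy). rewrite sqD in Hc.
  specialize (pos y Ay). lia. }
assert (cs : forall x, A x -> (kdot a x <= N)%Z /\ (kdot a x = N -> x = a)).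
{ intros x Ax. specialize (Hc x Ax). pose proof (pos a Aa). pose proof (pos x Ax).
  pose proof (kdet_kdot_identity a x x) as E.
  assert (P : (0 <= kdet a x * kdet a x)%Z) by nia.
  assert (Hle : (kdot a x * kdot a x <= N * N)%Z) by nia.
  split; [nia|]. intros Hx. apply (kdot_kdet_inj a); [now apply nz|congruence|].
  assert (kdet a x = 0%Z) by nia. unfold kdet in *; lia. }
assert (addC : forall x y, kadd x y = kadd y x)
  by (intros; unfold kadd; f_equal; ring).
assert (cancel : forall x y z, kadd x y = kadd x z -> y = z).
{ intros [] [] []; unfold kadd; simpl; intros E; injection E; intros; f_equal; lia. }
(* The pair $(a, y)$ is isolated. In $l + m = a + y$, if one summand is off the circle, its product
   with $a$ is at most $a \cdot b = a \cdot y$. The other then has product at least $N$ with $a$, so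
   it equals $a$ by [cs]. Two summands on the circle have the same length. *)
assert (par : forall y, A y -> kdot y y <> N -> kdot a y = kdot a b -> kdet a y = 0%Z).
{ intros y Ay Ny ay.
  destruct (isolated_pair a y Aa Ay) as [H|H]; [apply out; auto; lia| |easy|congruence].
  intros l m Al Am lm.
  assert (E := f_equal (kdot a) lm); rewrite !dotD in E.
  destruct (Z.eq_dec (kdot l l) N) as [Nl|Nl];
  [destruct (Z.eq_dec (kdot m m) N) as [Nm|Nm]|].
  - right; left; congruence.
  - right; right; left. apply cs; [easy|].
    pose proof (max_ab a m Aa Am Na Nm). pose proof (proj1 (cs l Al)). lia.
  - right; right; right.
    assert (m = a).
    { apply cs; [easy|].
      pose proof (max_ab a l Aa Al Na Nl). pose proof (proj1 (cs m Am)). lia. }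
    subst m. rewrite (addC l) in lm. now apply cancel in lm. }
assert (pb := par b Ab Nb eq_refl).
exists a; split; [now apply nz|].
apply NNPP; intros NP.
(* Suppose some element of the support is off the line of $a$. Among these, $d$ has the largest
   product with $a$; the pairs $(a, d)$ and $(d, b)$ will give the contradiction. *)
destruct (exists_maximizer (kdot a) L (fun k => A k /\ kdet a k <> 0%Z)) as [d [[Ad Dd] Hd]].
{ intros k [Ak _]; now apply finA. }
{ apply NNPP; intros NE; apply NP; intros k Ak; apply NNPP; intros Dk; apply NE; now exists k. }
assert (ad0 : (0 <= kdot a d)%Z).
{ specialize (Hd (kopp d)). rewrite kopp_dot, kopp_det in Hd.
  assert (- kdot a d <= kdot a d)%Z by (apply Hd; split; [now apply symA|lia]). lia. }
assert (Nd : kdot d d = N).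
{ destruct (isolated_pair a d Aa Ad) as [H|H]; [now apply out| |easy|congruence].
  intros l m Al Am lm.
  assert (E := f_equal (kdot a) lm); rewrite !dotD in E.
  assert (E' := f_equal (kdet a) lm); rewrite !detD in E'.
  assert (kdet a a = 0%Z) by (unfold kdet; ring).
  right; right.
  pose proof (proj1 (cs l Al)). pose proof (proj1 (cs m Am)).
  destruct (Z.eq_dec (kdet a m) 0) as [Dm|Dm].
  - right. assert (Dl : kdet a l <> 0%Z) by lia.
    pose proof (Hd l (conj Al Dl)).
    assert (m = a) by (apply cs; [easy|lia]). subst m.
    rewrite (addC l) in lm. now apply cancel in lm.
  - left. pose proof (Hd m (conj Am Dm)). apply cs; [easy|lia]. }
pose proof (pos a Aa) as pa. rewrite Na in pa.
assert (adN : (kdot a d < N)%Z).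
{ destruct (cs d Ad) as [H1 H2].
  destruct (Z.eq_dec (kdot a d) N) as [e|]; [|lia].
  rewrite (H2 e) in Dd. destruct Dd; unfold kdet; ring. }
assert (abN : (kdot a b < N)%Z).
{ destruct (cs b Ab) as [H1 H2].
  destruct (Z.eq_dec (kdot a b) N) as [e|]; [|lia].
  rewrite (H2 e) in Nb. easy. }
assert (E1 := kdet_kdot_identity a d b). rewrite pb, Na in E1.
(* Since $b$ is parallel to $a$, [E1] reduces to $N (d \cdot b) = (a \cdot d)(a \cdot b)$. *)
assert (db0 : (0 <= kdot d b)%Z) by nia.
destruct (isolated_pair d b Ad Ab) as [H|H]; [now apply out| | |congruence].
(* If $d$ and $b$ were parallel, then $a \cdot b = 0$ because [kdet a d] is nonzero; as $b$ is also
   parallel to $a$, this would force $b = 0$. *)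
2:{ assert (E2 := kdet_kdot_identity a d d).
    assert (Hb := kdet_kdot_identity a b b). rewrite pb in Hb. pose proof (pos b Ab).
    assert (F : (kdot a b * kdet a d = 0)%Z).
    { assert (G : (kdot a a * kdet d b = kdot a d * kdet a b - kdet a d * kdot a b)%Z)
        by (unfold kdet, kdot; ring).
      rewrite H, pb in G. lia. }
    nia. }
assert (core : forall l m, A l -> A m -> kadd l m = kadd d b -> kdot l l <> N -> l = b).
{ intros l m Al Am lm Nl.
  assert (E := f_equal (kdot a) lm); rewrite !dotD in E.
  assert (E' := f_equal (kdet a) lm); rewrite !detD in E'.
  pose proof (max_ab a l Aa Al Na Nl) as Hl.
  destruct (Z.eq_dec (kdet a m) 0) as [Dm|Dm].
  - exfalso.
    destruct (Z.le_gt_cases (kdot a m) (kdot a b)) as [Hm|Hm].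
    + (* [|l|^2 >= N] since [l = d + (b - m)] with [b - m] a nonnegative multiple of [a] *)
      assert (I := kdet_kdot_identity a l l).
      assert (I2 := kdet_kdot_identity a d d).
      specialize (Hc l Al).
      assert (kdet a l = kdet a d) as EE by lia. rewrite EE in I.
      assert (kdot a d <= kdot a l)%Z by lia.
      rewrite Na in I, I2. rewrite Nd in I2.
      apply Nl. nia.
    + assert (m = a).
      { assert (kdot m m = N).
        { apply NNPP; intro Nm; pose proof (max_ab a m Aa Am Na Nm); lia. }
        assert (I := kdet_kdot_identity a m m). rewrite Dm in I.
        apply cs; [easy|]. nia. }
      subst m. rewrite Na in E.
      (* Here $l = d + b - a$ is off the circle, so $d \cdot l \le a \cdot b$. Multiplied by $N$ and
         combined with [E1], this reads $(N - a \cdot d)(N - a \cdot b) \le 0$, while both factors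
         are positive. *)
      pose proof (max_ab d l Ad Al Nd Nl) as Hdl.
      assert (E3 := f_equal (kdot d) lm); rewrite !dotD in E3. rewrite Nd in E3.
      assert (kdot d a = kdot a d) by (unfold kdot; ring).
      nia.
  - pose proof (Hd m (conj Am Dm)).
    assert (al : kdot a l = kdot a b) by lia.
    apply (kdot_kdet_inj a); [now apply nz|easy|].
    rewrite pb. now apply par. }
intros l m Al Am lm.
destruct (Z.eq_dec (kdot l l) N) as [Nl|Nl];
[destruct (Z.eq_dec (kdot m m) N) as [Nm|Nm]|].
- right; left; congruence.
- right; right; left. rewrite (addC l) in lm.
  pose proof (core m l Am Al lm Nm); subst m.
  rewrite (addC d) in lm. now apply cancel in lm.
- right; right; right. now apply (core l m).
Qed.

(** * Uniqueness of Fourier coefficients *)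

(** Componentwise, because integrals and derivatives are computed on real and imaginary parts
    separately. *)
Definition ccont {U : UniformSpace} (f : U -> C) : Prop :=
  forall x, continuous (fun y => fst (f y)) x /\ continuous (fun y => snd (f y)) x.

Lemma ccont_const {U : UniformSpace} (c : C) : ccont (fun _ : U => c).
Proof. intros x; split; apply continuous_const. Qed.

Lemma ccont_plus {U : UniformSpace} (f g : U -> C) :
  ccont f -> ccont g -> ccont (fun x => f x + g x)%C.
Proof.
intros Hf Hg x; destruct (Hf x), (Hg x); split;
  now apply (continuous_plus (V := R_NormedModule)).
Qed.

Lemma ccont_mult {U : UniformSpace} (f g : U -> C) :
  ccont f -> ccont g -> ccont (fun x => f x * g x)%C.
Proof.
intros Hf Hg x; destruct (Hf x), (Hg x); split; simpl.
- apply (continuous_minus (V := R_NormedModule));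
  now apply (continuous_mult (K := R_AbsRing)).
- apply (continuous_plus (V := R_NormedModule));
  now apply (continuous_mult (K := R_AbsRing)).
Qed.

Lemma ccont_expi {U : UniformSpace} (f : U -> R) :
  (forall x, continuous f x) -> ccont (fun x => expi (f x)).
Proof.
intros Hf x; split; simpl.
- apply continuous_comp; [apply Hf|apply continuous_cos].
- apply continuous_comp; [apply Hf|apply continuous_sin].
Qed.

Lemma ccont_comp {U V : UniformSpace} (f : V -> C) (g : U -> V) :
  ccont f -> (forall x, continuous g x) -> ccont (fun x => f (g x)).
Proof.
intros Hf Hg x; destruct (Hf (g x)); split.
- now apply (continuous_comp g (fun y => fst (f y))).
- now apply (continuous_comp g (fun y => snd (f y))).
Qed.

Lemma continuous_pair_r (x1 x2 : R) : continuous (fun y : R => (x1, y)) x2.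
Proof.
intros P [d Hd]; exists d; intros y Hy; apply Hd; split; [apply ball_center|exact Hy].
Qed.

Lemma continuous_pair_l (x1 x2 : R) : continuous (fun y : R => (y, x2)) x1.
Proof.
intros P [d Hd]; exists d; intros y Hy; apply Hd; split; [exact Hy|apply ball_center].
Qed.

(** * Complex integrals over one period and uniqueness on the circle *)

Definition cint (f : R -> C) : C :=
  (RInt (fun x => fst (f x)) 0 (2 * PI), RInt (fun x => snd (f x)) 0 (2 * PI)).

Lemma ccont_ex_RInt (f : R -> C) a b : ccont f ->
  ex_RInt (fun x => fst (f x)) a b /\ ex_RInt (fun x => snd (f x)) a b.
Proof. intros Hf; split; apply (ex_RInt_continuous (V := R_CompleteNormedModule)); intros; apply Hf. Qed.

Lemma RInt_cint (f : R -> C) : ccont f ->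
  RInt (V := C_R_CompleteNormedModule) f 0 (2 * PI) = cint f.
Proof.
intros Hf; apply is_RInt_unique.
destruct (ccont_ex_RInt f 0 (2 * PI) Hf).
apply (is_RInt_fct_extend_pair (U := R_NormedModule) (V := R_NormedModule));
 now apply (RInt_correct (V := R_CompleteNormedModule)).
Qed.

Lemma cint_ext (f g : R -> C) : (forall x, f x = g x) -> cint f = cint g.
Proof. intros H; unfold cint; f_equal; apply RInt_ext; intros; now rewrite H. Qed.

Lemma cint_plus (f g : R -> C) : ccont f -> ccont g ->
  cint (fun x => f x + g x)%C = (cint f + cint g)%C.
Proof.
intros Hf Hg; destruct (ccont_ex_RInt f 0 (2 * PI) Hf), (ccont_ex_RInt g 0 (2 * PI) Hg).
unfold cint, Cplus; simpl; f_equal; now apply (RInt_plus (V := R_CompleteNormedModule)).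
Qed.

Lemma cint_scal (c : C) (f : R -> C) : ccont f ->
  cint (fun x => c * f x)%C = (c * cint f)%C.
Proof.
intros Hf; destruct (ccont_ex_RInt f 0 (2 * PI) Hf) as [H1 H2].
assert (S1 := fun l => RInt_scal (V := R_CompleteNormedModule) _ 0 (2 * PI) l H1).
assert (S2 := fun l => RInt_scal (V := R_CompleteNormedModule) _ 0 (2 * PI) l H2).
assert (E1 := fun l => ex_RInt_scal (V := R_NormedModule) _ 0 (2 * PI) l H1).
assert (E2 := fun l => ex_RInt_scal (V := R_NormedModule) _ 0 (2 * PI) l H2).
unfold cint, Cmult; simpl; f_equal; rewrite <- S1, <- S2.
- now apply (RInt_minus (V := R_CompleteNormedModule)).
- now apply (RInt_plus (V := R_CompleteNormedModule)).
Qed.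

Lemma cint_zero : cint (fun _ => RtoC 0) = RtoC 0.
Proof.
unfold cint; simpl; rewrite RInt_const. unfold scal; simpl; unfold mult; simpl.
now rewrite Rmult_0_r.
Qed.

Lemma expi_plus (a b : R) : expi (a + b) = (expi a * expi b)%C.
Proof. unfold expi, Cmult; simpl; rewrite cos_plus, sin_plus; f_equal; ring. Qed.

Lemma expi_0 : expi 0 = RtoC 1.
Proof. unfold expi; now rewrite cos_0, sin_0. Qed.

Lemma cos_sin_periodZ (x : R) (n : Z) :
  cos (x + 2 * IZR n * PI) = cos x /\ sin (x + 2 * IZR n * PI) = sin x.
Proof.
destruct (Z.le_ge_cases 0 n) as [H|H].
- rewrite <- (Z2Nat.id n H), <- INR_IZR_INZ. now rewrite cos_period, sin_period.
- pose (m := Z.to_nat (- n)).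
  assert (E : x = (x + 2 * IZR n * PI) + 2 * INR m * PI).
  { unfold m; rewrite INR_IZR_INZ, Z2Nat.id by lia. rewrite opp_IZR; ring. }
  rewrite E at 2 4. now rewrite cos_period, sin_period.
Qed.

Lemma expi_2PI (n : Z) : expi (IZR n * (2 * PI)) = RtoC 1.
Proof.
replace (IZR n * (2 * PI)) with (0 + 2 * IZR n * PI) by ring.
unfold expi; destruct (cos_sin_periodZ 0 n) as [-> ->]; now rewrite cos_0, sin_0.
Qed.

Lemma cint_expi (n : Z) :
  cint (fun x => expi (IZR n * x)) = if Z.eq_dec n 0 then RtoC (2 * PI) else RtoC 0.
Proof.
destruct (Z.eq_dec n 0) as [->|Hn].
- unfold cint; rewrite (RInt_ext _ (fun _ => 1)), (RInt_ext (fun x => snd _) (fun _ => 0)).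
  + rewrite !RInt_const; unfold scal; simpl; unfold mult; simpl; unfold RtoC; f_equal; ring.
  + intros; simpl; now rewrite Rmult_0_l, sin_0.
  + intros; simpl; now rewrite Rmult_0_l, cos_0.
- assert (Hr : IZR n <> 0) by now apply not_0_IZR.
  assert (E := expi_2PI n). unfold expi, RtoC in E; injection E; intros Es Ec.
  unfold cint, RtoC; f_equal; apply is_RInt_unique; simpl.
  + replace 0 with (minus (sin (IZR n * (2 * PI)) / IZR n) (sin (IZR n * 0) / IZR n)) at 2.
    * apply (is_RInt_derive (fun x => sin (IZR n * x) / IZR n)).
      -- intros; auto_derive; [easy|field; easy].
      -- intros; apply (ex_derive_continuous (fun x => cos (IZR n * x))); auto_derive; easy.
    * rewrite Es, Rmult_0_r, sin_0. unfold minus, plus, opp; simpl; field; easy.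
  + replace 0 with (minus (- cos (IZR n * (2 * PI)) / IZR n) (- cos (IZR n * 0) / IZR n)) at 2.
    * apply (is_RInt_derive (fun x => - cos (IZR n * x) / IZR n)).
      -- intros; auto_derive; [easy|field; easy].
      -- intros; apply (ex_derive_continuous (fun x => sin (IZR n * x))); auto_derive; easy.
    * rewrite Ec, Rmult_0_r, cos_0. unfold minus, plus, opp; simpl; field; easy.
Qed.

(* [1 + cos (x - x0) - cos d] is at least [q > 1] within [d / 2] of [x0], and at
   most [1] in absolute value at distance [d] or more. *)
Lemma peak_kernel_separates (f : R -> R) (x0 : R) :
  (forall x, continuous f x) -> 0 < x0 < 2 * PI ->
  (forall (d : R) (n : nat),
     RInt (fun x => f x * (1 + cos (x - x0) - cos d) ^ n) 0 (2 * PI) = 0) ->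
  f x0 <= 0.
Proof.
intros Cf Hx0 H. apply Rnot_lt_le; intros Hpos.
pose proof PI_RGT_0 as HPI.
assert (Hc : 0 < f x0 / 2) by lra. set (c := f x0 / 2) in *.
destruct (proj1 (filterlim_locally f (f x0)) (Cf x0) (mkposreal c Hc)) as [d0 Hd0].
(* Below [d0], $f$ stays above [c]. Below $\pi/2$, cosine is decreasing on $[0, d]$. Below $x_0$ and
   $2\pi - x_0$, the peak lies inside the period and every point of the period is within $2\pi - d$
   of $x_0$. Halving makes all bounds strict. *)
pose (d := Rmin (Rmin d0 (PI / 2)) (Rmin x0 (2 * PI - x0)) / 2).
assert (Hd : 0 < d /\ d < d0 /\ d < PI / 2 /\ d < x0 /\ d < 2 * PI - x0).
{ unfold d. pose proof (cond_pos d0).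
  assert (0 < Rmin (Rmin d0 (PI / 2)) (Rmin x0 (2 * PI - x0))).
  { repeat apply Rmin_glb_lt; lra. }
  pose proof (Rmin_l (Rmin d0 (PI / 2)) (Rmin x0 (2 * PI - x0))).
  pose proof (Rmin_r (Rmin d0 (PI / 2)) (Rmin x0 (2 * PI - x0))).
  pose proof (Rmin_l d0 (PI / 2)). pose proof (Rmin_r d0 (PI / 2)).
  pose proof (Rmin_l x0 (2 * PI - x0)). pose proof (Rmin_r x0 (2 * PI - x0)). lra. }
clearbody d. destruct Hd as [d_pos [d_d0 [d_PI [d_x0 d_x1]]]].
assert (Hnear : forall x, Rabs (x - x0) <= d -> c <= f x).
{ intros x Hx. assert (B : ball x0 d0 x) by (unfold ball; simpl; unfold AbsRing_ball, abs, minus, plus, opp; simpl; fold (x - x0); lra).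
  specialize (Hd0 x B). unfold ball in Hd0; simpl in Hd0.
  unfold AbsRing_ball, abs, minus, plus, opp in Hd0; simpl in Hd0.
  apply Rabs_def2 in Hd0. unfold c in *. lra. }
set (T := fun x => 1 + cos (x - x0) - cos d).
assert (cosabs : forall y, cos y = cos (Rabs y)).
{ intros y; unfold Rabs; destruct Rcase_abs; [now rewrite cos_neg|easy]. }
assert (Tin : forall e x, 0 <= e <= d -> Rabs (x - x0) <= e -> 1 + cos e - cos d <= T x).
{ intros e x He Hx. unfold T. rewrite (cosabs (x - x0)).
  assert (cos e <= cos (Rabs (x - x0))).
  { apply cos_decr_1; try lra; pose proof (Rabs_pos (x - x0)); lra. }
  lra. }
assert (cosd : 0 <= cos d) by (apply cos_ge_0; lra).
assert (Tout : forall x, 0 < x < 2 * PI -> d <= Rabs (x - x0) -> Rabs (T x) <= 1).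
{ intros x Hx Hxd. unfold T. rewrite (cosabs (x - x0)).
  set (y := Rabs (x - x0)) in *.
  assert (Hy : y <= 2 * PI - d).
  { unfold y, Rabs; destruct Rcase_abs; lra. }
  assert (cos y <= cos d).
  { destruct (Rle_lt_dec y PI) as [Hy'|Hy'].
    - apply cos_decr_1; lra.
    - replace (cos y) with (cos (2 * PI - y)).
      + apply cos_decr_1; lra.
      + rewrite cos_minus, cos_2PI, sin_2PI; ring. }
  pose proof (COS_bound y); pose proof (COS_bound d). apply Rabs_le; lra. }
set (q := 1 + cos (d / 2) - cos d).
assert (Hq : 1 < q).
{ unfold q. assert (cos d < cos (d / 2)) by (apply cos_decreasing_1; lra). lra. }
assert (CT : forall n x, continuous (fun x => f x * T x ^ n) x).
{ intros n x; apply (continuous_mult (K := R_AbsRing)); [apply Cf|].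
  apply (ex_derive_continuous (fun x => T x ^ n)). unfold T; auto_derive; easy. }
assert (EI : forall n a b, ex_RInt (fun x => f x * T x ^ n) a b).
{ intros; apply (ex_RInt_continuous (V := R_CompleteNormedModule)); intros; apply CT. }
destruct (continuity_ab_maj (fun x => Rabs (f x)) 0 (2 * PI)) as [xm [HM _]]; [lra| |].
{ intros x _. apply continuity_pt_filterlim.
  apply (continuous_comp f Rabs); [apply Cf|apply (continuous_abs (K := R_AbsRing))]. }
set (M := Rabs (f xm)) in HM.
assert (M0 : 0 <= M) by apply Rabs_pos.
assert (low : forall n x, 0 < x < 2 * PI -> - M <= f x * T x ^ n).
{ intros n x Hx. destruct (Rle_lt_dec d (Rabs (x - x0))) as [Hd|Hd].
  - assert (Rabs (f x * T x ^ n) <= M * 1).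
    { rewrite Rabs_mult. apply Rmult_le_compat; try apply Rabs_pos; [apply HM; lra|].
      rewrite <- RPow_abs. rewrite <- (pow1 n). apply pow_incr.
      split; [apply Rabs_pos|now apply Tout]. }
    apply Rabs_le_between in H0. lra.
  - assert (c <= f x) by (apply Hnear; lra).
    assert (T1 : 1 + cos d - cos d <= T x) by (apply (Tin d); lra).
    assert (0 <= T x ^ n) by (apply pow_le; lra). nra. }
assert (mid : forall n x, Rabs (x - x0) <= d / 2 -> c * q ^ n <= f x * T x ^ n).
{ intros n x Hx.
  assert (c <= f x) by (apply Hnear; lra).
  assert (T1 : q <= T x) by (apply (Tin (d / 2)); lra).
  apply Rmult_le_compat; try lra.
  - apply pow_le; lra.
  - apply pow_incr; lra. }
(* The vanishing integral is split at $x_0 \pm d/2$. The middle piece is at least $d \, c \, q^n$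
   and the two outer pieces together at least $-2\pi M$. Since $q > 1$, this fails for large $n$. *)
assert (key : forall n, d * (c * q ^ n) <= 2 * PI * M).
{ intros n. specialize (H d n). fold T in H.
  change (RInt (fun x => f x * T x ^ n) 0 (2 * PI) = 0) in H.
  rewrite <- (RInt_Chasles _ 0 (x0 - d / 2) (2 * PI)) in H by apply EI.
  rewrite <- (RInt_Chasles _ (x0 - d / 2) (x0 + d / 2) (2 * PI)) in H by apply EI.
  unfold plus in H; simpl in H.
  assert (L : forall a b k, a <= b ->
    (forall x, a < x < b -> k <= f x * T x ^ n) -> (b - a) * k <= RInt (fun x => f x * T x ^ n) a b).
  { intros a b k Hab Hk.
    replace ((b - a) * k) with (RInt (fun _ => k) a b) by (rewrite RInt_const; reflexivity).
    apply RInt_le; [easy|apply ex_RInt_const|apply EI|easy]. }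
  assert (L1 := L 0 (x0 - d / 2) (- M)). assert (L3 := L (x0 + d / 2) (2 * PI) (- M)).
  assert (L2 := L (x0 - d / 2) (x0 + d / 2) (c * q ^ n)).
  assert (0 <= d * M) by nra.
  specialize (L1 ltac:(lra) ltac:(intros; apply low; lra)).
  specialize (L3 ltac:(lra) ltac:(intros; apply low; lra)).
  specialize (L2 ltac:(lra) ltac:(intros; apply mid; apply Rabs_le; lra)).
  nra. }
destruct (Pow_x_infinity q) with (b := (2 * PI * M + 1) / (d * c)) as [n Hn].
{ rewrite Rabs_pos_eq; lra. }
specialize (Hn n (le_n n)). specialize (key n).
rewrite Rabs_pos_eq in Hn by (apply pow_le; lra).
assert (0 < d * c) by nra.
apply Rge_le in Hn. apply (Rmult_le_compat_l (d * c)) in Hn; [|lra].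
replace (d * c * ((2 * PI * M + 1) / (d * c))) with (2 * PI * M + 1) in Hn by (field; nra).
nra.
Qed.

Lemma ccont_expi_lin (a : R) : ccont (fun x : R => expi (a * x)).
Proof.
apply (ccont_expi (fun x : R => a * x)); intros x.
apply (ex_derive_continuous (fun x => a * x)); auto_derive; easy.
Qed.

(** The kernel is a trigonometric polynomial of degree one, so each further factor only shifts the
    frequency by $-1$, $0$ or $1$. The induction therefore needs all [k] at once, and continuity is
    carried along to make the integral linear. *)
Lemma cint_peak_power (f : R -> C) (x0 d : R) (n : nat) : ccont f ->
  (forall k : Z, cint (fun x => f x * expi (IZR k * x))%C = RtoC 0) ->
  ccont (fun x : R => RtoC ((1 + cos (x - x0) - cos d) ^ n)) /\
  forall k : Z, cint (fun x => f x * RtoC ((1 + cos (x - x0) - cos d) ^ n)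
                               * expi (IZR k * x))%C = RtoC 0.
Proof.
intros Cf Hf; induction n as [|n [IHc IH]].
- split; [exact (ccont_const (U := R_UniformSpace) (RtoC 1))|]. intros k; rewrite <- (Hf k); apply cint_ext; intros x; simpl.
  now rewrite Cmult_1_r.
- set (T := fun x => 1 + cos (x - x0) - cos d).
  assert (HT : forall x, RtoC (T x) = (RtoC (1 - cos d) + (RtoC (/ 2) * expi (- x0)) * expi (IZR 1 * x)
                          + (RtoC (/ 2) * expi x0) * expi (IZR (-1) * x))%C).
  { intros x; unfold T, expi, RtoC, Cmult, Cplus; simpl.
    rewrite cos_minus, cos_neg, sin_neg, !Rmult_1_l.
    replace (-1 * x) with (- x) by ring. rewrite cos_neg, sin_neg.
    f_equal; field. }
  assert (Hpow : forall x, RtoC (T x ^ S n) = (RtoC (T x ^ n) * RtoC (T x))%C).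
  { intros x; rewrite <- RtoC_mult; f_equal; simpl; ring. }
  split.
  + assert (H : ccont (fun x : R => RtoC (T x ^ n) * RtoC (T x))%C).
    { apply ccont_mult; [exact IHc|].
      intros x; split; [|apply continuous_const]. simpl.
      apply (ex_derive_continuous T); unfold T; auto_derive; easy. }
    intros x; destruct (H x) as [H1 H2]; split.
    * eapply continuous_ext; [|exact H1]. intros y; simpl; unfold T; ring.
    * eapply continuous_ext; [|exact H2]. intros y; simpl; ring.
  + intros k.
    rewrite (cint_ext _ (fun x =>
        (RtoC (1 - cos d) * (f x * RtoC (T x ^ n) * expi (IZR k * x))
        + (RtoC (/ 2) * expi (- x0)) * (f x * RtoC (T x ^ n) * expi (IZR (1 + k) * x)))
        + (RtoC (/ 2) * expi x0) * (f x * RtoC (T x ^ n) * expi (IZR (-1 + k) * x)))%C).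
    * assert (CC : forall j, ccont (fun x => f x * RtoC (T x ^ n) * expi (IZR j * x))%C).
      { intros j; exact (ccont_mult _ _ (ccont_mult _ _ Cf IHc) (ccont_expi_lin _)). }
      assert (CS : forall c j, ccont (fun x => c * (f x * RtoC (T x ^ n) * expi (IZR j * x)))%C).
      { intros c j; apply (ccont_mult (fun _ => c)); [apply ccont_const|apply CC]. }
      rewrite cint_plus; [|now apply ccont_plus|easy].
      rewrite cint_plus by easy. rewrite !cint_scal by easy.
      unfold T; rewrite !IH. ring.
    * intros x. fold (T x). rewrite Hpow, HT, !plus_IZR, !Rmult_plus_distr_r, !expi_plus. ring.
Qed.

(** The kernel is real, so real and imaginary parts separate; the one-sided bound
    [peak_kernel_separates] is applied to each part and to its opposite. *)
Lemma cint_coef_zero (f : R -> C) : ccont f ->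
  (forall k : Z, cint (fun x => f x * expi (IZR k * x))%C = RtoC 0) ->
  forall x, 0 < x < 2 * PI -> f x = RtoC 0.
Proof.
intros Cf Hf x Hx.
assert (H : forall d n,
  RInt (fun y => fst (f y) * (1 + cos (y - x) - cos d) ^ n) 0 (2 * PI) = 0 /\
  RInt (fun y => snd (f y) * (1 + cos (y - x) - cos d) ^ n) 0 (2 * PI) = 0).
{ intros d n. destruct (cint_peak_power f x d n Cf Hf) as [_ H].
  specialize (H 0%Z). unfold cint, RtoC in H. injection H; intros H2 H1.
  split; [eapply eq_trans; [|exact H1]|eapply eq_trans; [|exact H2]]; apply RInt_ext; intros y _; simpl;
  rewrite Rmult_0_l, cos_0, sin_0; ring. }
assert (N : forall (g : R -> R), (forall x, continuous g x) ->
  (forall d n, RInt (fun y => g y * (1 + cos (y - x) - cos d) ^ n) 0 (2 * PI) = 0) -> g x = 0).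
{ intros g Cg Hg. apply Rle_antisym; [now apply peak_kernel_separates|].
  assert (- g x <= 0); [|lra].
  apply (peak_kernel_separates (fun y => - g y)); [|easy|].
  - intros y; now apply (continuous_opp (V := R_NormedModule)).
  - intros d n. rewrite (RInt_ext _ (fun y => opp (g y * (1 + cos (y - x) - cos d) ^ n))).
    + rewrite (RInt_opp (V := R_CompleteNormedModule)), Hg; [apply Ropp_0|].
      apply (ex_RInt_continuous (V := R_CompleteNormedModule)); intros z _.
      apply (continuous_mult (K := R_AbsRing)); [apply Cg|].
      apply (ex_derive_continuous (fun y => (1 + cos (y - x) - cos d) ^ n)); auto_derive; easy.
    + intros y _; unfold opp; simpl; ring. }
unfold RtoC. rewrite (surjective_pairing (f x)); f_equal.
- apply (N (fun y => fst (f y))); [apply Cf|apply H].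
- apply (N (fun y => snd (f y))); [apply Cf|apply H].
Qed.

Lemma floor_2PI (x : R) : exists n : Z, 0 <= x + 2 * IZR n * PI < 2 * PI.
Proof.
pose proof PI_RGT_0. destruct (archimed (x / (2 * PI))) as [H1 H2].
exists (1 - up (x / (2 * PI)))%Z. rewrite minus_IZR.
set (m := IZR (up (x / (2 * PI)))) in *.
assert (E : x = x / (2 * PI) * (2 * PI)) by (field; lra).
set (y := x / (2 * PI)) in *. nra.
Qed.

(** The peak argument works only at interior points of the period; the point 0 is recovered by
    continuity and the rest by translation. *)
Lemma periodic_zero (f : R -> C) : ccont f ->
  (forall x, f (x + 2 * PI) = f x) ->
  (forall x, 0 < x < 2 * PI -> f x = RtoC 0) -> forall x, f x = RtoC 0.
Proof.
intros Cf Pf Zf.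
pose proof PI_RGT_0 as HPI.
assert (Pn : forall n x, f (x + 2 * INR n * PI) = f x).
{ induction n as [|n IH]; intros x.
  - simpl; f_equal; ring.
  - rewrite S_INR. replace (x + 2 * (INR n + 1) * PI) with (x + 2 * INR n * PI + 2 * PI) by ring.
    now rewrite Pf. }
assert (PZ : forall n x, f (x + 2 * IZR n * PI) = f x).
{ intros n x; destruct (Z.le_ge_cases 0 n) as [H|H].
  - rewrite <- (Z2Nat.id n H), <- INR_IZR_INZ. apply Pn.
  - rewrite <- (Pn (Z.to_nat (- n)) (x + _)).
    rewrite INR_IZR_INZ, Z2Nat.id, opp_IZR by lia. f_equal; ring. }
assert (Z0 : f 0 = RtoC 0).
{ assert (N : forall g : R -> R, continuous g 0 ->
    (forall x, 0 < x < 2 * PI -> g x = 0) -> g 0 = 0).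
  { intros g Cg Hg. apply NNPP; intros Hne.
    assert (He : 0 < Rabs (g 0)) by now apply Rabs_pos_lt.
    destruct (proj1 (filterlim_locally g (g 0)) Cg (mkposreal _ He)) as [d Hd].
    pose (x := Rmin d PI / 2). pose proof (cond_pos d).
    assert (0 < Rmin d PI) by (apply Rmin_glb_lt; lra).
    pose proof (Rmin_l d PI). pose proof (Rmin_r d PI).
    assert (B : ball 0 d x).
    { unfold ball; simpl; unfold AbsRing_ball, abs, minus, plus, opp, x; simpl.
      rewrite Rabs_pos_eq; lra. }
    specialize (Hd x B). rewrite Hg in Hd by (unfold x; lra).
    unfold ball in Hd; simpl in Hd. unfold AbsRing_ball, abs, minus, plus, opp in Hd; simpl in Hd.
    rewrite Rplus_0_l, Rabs_Ropp in Hd. lra. }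
  unfold RtoC; rewrite (surjective_pairing (f 0)); f_equal.
  - apply (N (fun y => fst (f y))); [apply Cf|]. intros; now rewrite Zf.
  - apply (N (fun y => snd (f y))); [apply Cf|]. intros; now rewrite Zf. }
intros x. destruct (floor_2PI x) as [n Hn]. rewrite <- (PZ n).
destruct (Req_dec (x + 2 * IZR n * PI) 0) as [->|H]; [easy|apply Zf; lra].
Qed.

(** * From the circle to the torus *)

Lemma continuous_RInt_param (f : R * R -> R) (a b : R) : a <= b ->
  (forall x, continuous f x) ->
  forall x, continuous (fun x1 => RInt (fun x2 => f (x1, x2)) a b) x.
Proof.
intros Hab Cf x. apply filterlim_locally; intros eps.
assert (He : 0 < eps / (b - a + 1)).
{ pose proof (cond_pos eps). apply Rdiv_lt_0_compat; lra. }
(* Uniform continuity on a compact rectangle bounds the integrand difference by [eps / (b - a + 1)];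
   the added 1 keeps the quotient meaningful when [a = b]. *)
destruct (uniform_continuity_2d (fun u v => f (u, v)) (x - 1) (x + 1) a b) with
  (eps := mkposreal _ He) as [d Hd].
{ intros u v _ _. apply continuity_2d_pt_filterlim.
  eapply filterlim_ext; [|apply (Cf (u, v))]. now intros []. }
assert (Hd1 : 0 < Rmin d 1) by (apply Rmin_glb_lt; [apply cond_pos|lra]).
exists (mkposreal _ Hd1). intros y Hy.
unfold ball in *; simpl in *. unfold AbsRing_ball, abs, minus, plus, opp in *; simpl in *.
pose proof (Rmin_l d 1); pose proof (Rmin_r d 1).
fold (y - x) in Hy.
assert (EI : forall u, ex_RInt (fun x2 => f (u, x2)) a b).
{ intros u; apply (ex_RInt_continuous (V := R_CompleteNormedModule)); intros v _.
  apply (continuous_comp (fun v => (u, v)) f); [apply continuous_pair_r|apply Cf]. }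
fold (RInt (fun x2 : R => f (y, x2)) a b - RInt (fun x2 : R => f (x, x2)) a b).
rewrite <- (RInt_minus (V := R_CompleteNormedModule)) by apply EI.
apply Rle_lt_trans with ((b - a) * (eps / (b - a + 1))).
- apply abs_RInt_le_const; [easy|now apply (ex_RInt_minus (V := R_NormedModule))|].
  intros t Ht. apply Rlt_le, (Hd x t y t); try lra.
  + apply Rabs_def2 in Hy; lra.
  + rewrite Rminus_diag, Rabs_R0; apply cond_pos.
- pose proof (cond_pos eps).
  apply Rmult_lt_reg_r with (b - a + 1); [lra|]. field_simplify; lra.
Qed.

Lemma ccont_cint_param (F : R * R -> C) : ccont F ->
  ccont (fun x1 => cint (fun x2 => F (x1, x2))).
Proof.
intros CF x; pose proof PI_RGT_0; split; simpl.
- apply (continuous_RInt_param (fun p => fst (F p))); [lra|apply CF].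
- apply (continuous_RInt_param (fun p => snd (F p))); [lra|apply CF].
Qed.

Definition cfourier (F : R * R -> C) (k : Z * Z) : C :=
  cint (fun x1 => cint (fun x2 => F (x1, x2) * expi (- dotZ k (x1, x2)))%C).

Lemma continuous_dotZ (k : Z * Z) (x : R * R) : continuous (dotZ k) x.
Proof.
destruct x as [x1 x2]. unfold dotZ.
apply (continuous_plus (V := R_NormedModule));
apply (continuous_mult (K := R_AbsRing)); try apply continuous_const.
- apply continuous_fst.
- apply continuous_snd.
Qed.

Lemma ccont_char (k : Z * Z) : ccont (fun x : R * R => expi (dotZ k x)).
Proof. apply ccont_expi, continuous_dotZ. Qed.

Lemma ccont_char_opp (k : Z * Z) : ccont (fun x : R * R => expi (- dotZ k x)).
Proof.
apply (ccont_expi (fun x => - dotZ k x)); intros x.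
apply (continuous_opp (V := R_NormedModule)), continuous_dotZ.
Qed.

Lemma ccont_slice_r (F : R * R -> C) (x1 : R) : ccont F -> ccont (fun x2 => F (x1, x2)).
Proof. intros CF; apply (ccont_comp F (fun x2 => (x1, x2)) CF), continuous_pair_r. Qed.

Lemma ccont_slice_l (F : R * R -> C) (x2 : R) : ccont F -> ccont (fun x1 => F (x1, x2)).
Proof. intros CF; apply (ccont_comp F (fun x1 => (x1, x2)) CF); intros; apply continuous_pair_l. Qed.

Lemma fourier_cfourier (f : R * R -> R) (k : Z * Z) : (forall x, continuous f x) ->
  fourier f k = cfourier (fun x => RtoC (f x)) k.
Proof.
intros Cf.
assert (CF : ccont (fun x : R * R => RtoC (f x) * expi (- dotZ k x))%C).
{ apply ccont_mult; [|apply ccont_char_opp].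
  intros x; split; [apply Cf|apply continuous_const]. }
unfold fourier, cfourier.
rewrite <- RInt_cint.
- apply (RInt_ext (V := C_R_CompleteNormedModule)); intros x1 _. apply RInt_cint.
  exact (ccont_slice_r _ x1 CF).
- exact (ccont_cint_param _ CF).
Qed.

(** Uniqueness on the circle is used twice: first for the partial coefficients [G k2], which are
    continuous functions of $x_1$, then for each slice $x_2 \mapsto F(x_1, x_2)$. *)
Lemma cfourier_injective (F : R * R -> C) : ccont F -> on_torus F ->
  (forall k, cfourier F k = RtoC 0) -> forall x, F x = RtoC 0.
Proof.
intros CF PF HF.
pose (G := fun (k2 : Z) x1 => cint (fun x2 => F (x1, x2) * expi (IZR k2 * x2))%C).
assert (CFk : forall k2, ccont (fun x : R * R => F x * expi (IZR k2 * snd x))%C).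
{ intros k2; apply ccont_mult; [easy|].
  apply (ccont_comp (fun y => expi (IZR k2 * y)) snd); [apply ccont_expi_lin|].
  intros []; apply continuous_snd. }
assert (HG : forall k2 x1, 0 < x1 < 2 * PI -> G k2 x1 = RtoC 0).
{ intros k2; apply cint_coef_zero.
  - exact (ccont_cint_param _ (CFk k2)).
  (* The signs are reversed because [cint_coef_zero] tests against $e^{ikx}$ and [cfourier] against
     $e^{-ik \cdot x}$. *)
  - intros k1. rewrite <- (HF (- k1, - k2)%Z). apply cint_ext; intros x1.
    unfold G. rewrite Cmult_comm, <- cint_scal by exact (ccont_slice_r _ x1 (CFk k2)).
    apply cint_ext; intros x2. unfold dotZ; simpl. rewrite !opp_IZR.
    replace (- (- IZR k1 * x1 + - IZR k2 * x2)) with (IZR k1 * x1 + IZR k2 * x2) by ring.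
    rewrite expi_plus; ring. }
assert (H1 : forall x1, 0 < x1 < 2 * PI -> forall x2, F (x1, x2) = RtoC 0).
{ intros x1 Hx1. apply periodic_zero.
  - now apply ccont_slice_r.
  - intros x2; apply PF.
  - apply cint_coef_zero; [now apply ccont_slice_r|]. intros k2. exact (HG k2 x1 Hx1). }
intros [x1 x2]. revert x1. apply periodic_zero.
- now apply ccont_slice_l.
- intros x1; apply PF.
- intros; now apply H1.
Qed.

(** * Trigonometric polynomials *)

Definition csum {T : Type} (f : T -> C) (l : list T) : C :=
  fold_right (fun x s => f x + s)%C (RtoC 0) l.

Lemma csum_ext {T : Type} (f g : T -> C) (l : list T) :
  (forall x, In x l -> f x = g x) -> csum f l = csum g l.
Proof.
induction l as [|x l IH]; intros H; simpl; [easy|].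
rewrite H, IH; [easy| |now left]. intros y Hy; apply H; now right.
Qed.

Lemma csum_zero {T : Type} (f : T -> C) (l : list T) :
  (forall x, In x l -> f x = RtoC 0) -> csum f l = RtoC 0.
Proof.
intros H; rewrite (csum_ext _ (fun _ => RtoC 0)) by easy.
clear H; induction l as [|x l IH]; simpl; [easy|]. rewrite IH; ring.
Qed.

Lemma csum_plus {T : Type} (f g : T -> C) (l : list T) :
  csum (fun x => f x + g x)%C l = (csum f l + csum g l)%C.
Proof. induction l as [|x l IH]; simpl; [ring|]. rewrite IH; ring. Qed.

Lemma csum_scal {T : Type} (c : C) (f : T -> C) (l : list T) :
  csum (fun x => c * f x)%C l = (c * csum f l)%C.
Proof. induction l as [|x l IH]; simpl; [ring|]. rewrite IH; ring. Qed.

Lemma csum_app {T : Type} (f : T -> C) (l m : list T) :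
  csum f (l ++ m) = (csum f l + csum f m)%C.
Proof. induction l as [|x l IH]; simpl; [ring|]. rewrite IH; ring. Qed.

Lemma csum_map {T U : Type} (f : U -> C) (g : T -> U) (l : list T) :
  csum f (map g l) = csum (fun x => f (g x)) l.
Proof. induction l as [|x l IH]; simpl; [easy|]. now rewrite IH. Qed.

Lemma csum_prod {T U : Type} (f : T -> U -> C) (l : list T) (m : list U) :
  csum (fun p => f (fst p) (snd p)) (list_prod l m) = csum (fun x => csum (f x) m) l.
Proof.
induction l as [|x l IH]; simpl; [easy|]. rewrite csum_app, csum_map, IH; easy.
Qed.

Lemma csum_exchange {T U : Type} (f : T -> U -> C) (l : list T) (m : list U) :
  csum (fun x => csum (f x) m) l = csum (fun y => csum (fun x => f x y) l) m.
Proof.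
induction l as [|x l IH]; simpl; [now rewrite csum_zero|].
now rewrite IH, csum_plus.
Qed.

Lemma csum_single {T : Type} (f : T -> C) (l : list T) (x : T) :
  NoDup l -> In x l -> (forall y, In y l -> y <> x -> f y = RtoC 0) -> csum f l = f x.
Proof.
induction l as [|y l IH]; intros Hl Hx Hf; [easy|].
inversion Hl as [|? ? Hy Hl']; subst. simpl. destruct Hx as [->|Hx].
- rewrite csum_zero; [ring|]. intros z Hz; apply Hf; [now right|]. now intros ->.
- rewrite IH; [|easy|easy|intros; apply Hf; [now right|easy]].
  rewrite (Hf y); [ring|now left|now intros ->].
Qed.

Lemma csum_two {T : Type} (f : T -> C) (l : list T) (x y : T) :
  NoDup l -> In x l -> In y l -> x <> y ->
  (forall z, In z l -> z <> x -> z <> y -> f z = RtoC 0) -> csum f l = (f x + f y)%C.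
Proof.
induction l as [|z l IH]; intros Hl Hx Hy Hxy Hf; [easy|].
inversion Hl as [|? ? Hz Hl']; subst. simpl.
destruct Hx as [->|Hx]; destruct Hy as [->|Hy].
- easy.
- f_equal; apply csum_single; try easy.
  intros w Hw Hwy; apply Hf; [now right| |easy]. now intros ->.
- rewrite Cplus_comm; f_equal; apply csum_single; try easy.
  intros w Hw Hwy; apply Hf; [now right|easy|]. now intros ->.
- rewrite IH; try easy.
  + rewrite (Hf z); [ring|now left|now intros ->|now intros ->].
  + intros; apply Hf; [now right|easy|easy].
Qed.

Lemma NoDup_list_prod {T U : Type} (l : list T) (m : list U) :
  NoDup l -> NoDup m -> NoDup (list_prod l m).
Proof.
intros Hl Hm; induction Hl as [|x l Hx Hl IH]; simpl; [constructor|].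
apply NoDup_app; [|easy|].
- apply Injective_map_NoDup; [|easy]. intros a b E; now injection E.
- intros p H1 H2. apply in_map_iff in H1; destruct H1 as [y [<- _]].
  now apply in_prod_iff in H2.
Qed.

(** * Characters, sampling, and the algebra of trigonometric polynomials *)

Definition keq_dec (k l : Z * Z) : {k = l} + {k <> l}.
Proof. decide equality; apply Z.eq_dec. Defined.

Definition indic (k l : Z * Z) : C := if keq_dec k l then RtoC 1 else RtoC 0.

Lemma dotZ_kadd (k l : Z * Z) (x : R * R) : dotZ (kadd k l) x = dotZ k x + dotZ l x.
Proof. unfold dotZ, kadd; simpl; rewrite !plus_IZR; ring. Qed.

Definition echar (k : Z * Z) (x : R * R) : C := expi (dotZ k x).

Lemma echar_kadd (k l : Z * Z) (x : R * R) :
  echar (kadd k l) x = (echar k x * echar l x)%C.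
Proof. unfold echar; now rewrite dotZ_kadd, expi_plus. Qed.

Lemma echar_plus (k : Z * Z) (x y : R * R) :
  echar k (fst x + fst y, snd x + snd y) = (echar k x * echar k y)%C.
Proof. unfold echar; rewrite <- expi_plus; f_equal; unfold dotZ; simpl; ring. Qed.

Lemma expi_neq_1 (t : R) : 0 < t < 2 * PI -> expi t <> RtoC 1.
Proof.
intros Ht E. unfold expi, RtoC in E; injection E; intros Es Ec.
assert (H := sin2_cos2 (t / 2)).
assert (Hs : 0 < sin (t / 2)) by (apply sin_gt_0; lra).
replace t with (2 * (t / 2)) in Ec by field. rewrite cos_2a_sin in Ec. nra.
Qed.

Lemma echar_separates (k l : Z * Z) : k <> l -> exists x, echar k x <> echar l x.
Proof.
intros Hkl.
assert (H : forall m n : Z, m <> n -> exists t, expi (IZR m * t) <> expi (IZR n * t)).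
{ intros m n Hmn.
  assert (Hr : IZR m - IZR n <> 0) by (rewrite <- minus_IZR; apply not_0_IZR; lia).
  pose proof PI_RGT_0.
  (* At this point the quotient of the two exponentials is $e^{i\pi}$. *)
  exists (PI / (IZR m - IZR n)). intros E.
  apply (expi_neq_1 PI); [lra|].
  replace PI with (IZR m * (PI / (IZR m - IZR n)) + - (IZR n * (PI / (IZR m - IZR n)))) at 1
    by (field; easy).
  rewrite expi_plus, E, <- expi_plus, Rplus_opp_r; apply expi_0. }
destruct k as [k1 k2], l as [l1 l2]; unfold echar, dotZ; simpl.
destruct (Z.eq_dec k1 l1) as [->|H1].
- destruct (H k2 l2) as [t Ht]; [congruence|]. exists (0, t); simpl.
  now rewrite !Rmult_0_r, !Rplus_0_l.
- destruct (H k1 l1 H1) as [t Ht]. exists (t, 0); simpl.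
  now rewrite !Rmult_0_r, !Rplus_0_r.
Qed.

(* The weights [w] are obtained by composing, for [k] in [l] other than [K], the
   operators "translate by [x] minus [echar k x]", which annihilate [echar k]. *)
Lemma sampling (l : list (Z * Z)) (K : Z * Z) :
  exists W : list (C * (R * R)), forall k, In k l ->
    csum (fun w => fst w * echar k (snd w))%C W = indic k K.
Proof.
assert (H : exists W : list (C * (R * R)),
  csum (fun w => fst w * echar K (snd w))%C W = RtoC 1 /\
  forall k, In k l -> k <> K -> csum (fun w => fst w * echar k (snd w))%C W = RtoC 0).
{ induction l as [|k l [W [H1 H2]]].
  - exists ((RtoC 1, (0, 0)) :: nil); split; [|easy]. simpl.
    unfold echar, dotZ; simpl. rewrite !Rmult_0_r, Rplus_0_l, expi_0; ring.
  - destruct (keq_dec k K) as [->|Hk].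
    + exists W; split; [easy|]. intros j [->|Hj] HjK; [easy|now apply H2].
    + destruct (echar_separates k K Hk) as [x Hx].
      set (d := (echar K x - echar k x)%C).
      assert (Hd : d <> RtoC 0).
      { intros E; apply Hx. replace (echar K x) with (d + echar k x)%C by (unfold d; ring).
        rewrite E; ring. }
      (* These are the weights of the operator (translate by [x], minus [echar k x]) divided by [d],
         its eigenvalue on [echar K]. The division preserves the value 1 at [K], and frequencies
         already annihilated stay so. *)
      exists (map (fun w => ((fst w / d)%C, (fst (snd w) + fst x, snd (snd w) + snd x))) W ++
              map (fun w => ((- (echar k x / d) * fst w)%C, snd w)) W).
      assert (E : forall j, csum (fun w => fst w * echar j (snd w))%C
        (map (fun w => ((fst w / d)%C, (fst (snd w) + fst x, snd (snd w) + snd x))) W ++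
              map (fun w => ((- (echar k x / d) * fst w)%C, snd w)) W) =
        ((echar j x - echar k x) / d * csum (fun w => fst w * echar j (snd w)) W)%C).
      { intros j. rewrite csum_app, !csum_map, <- csum_scal, <- csum_plus.
        apply csum_ext; intros w _. cbn [fst snd]. rewrite echar_plus. field; easy. }
      split.
      * rewrite E, H1. fold d. field; easy.
      * intros j [<-|Hj] HjK; rewrite E.
        -- field; easy.
        -- rewrite H2 by easy. ring. }
destruct H as [W [H1 H2]]. exists W. intros k Hk. unfold indic.
destruct (keq_dec k K) as [->|HkK]; [easy|now apply H2].
Qed.

(* A list of pairs [(c, k)] stands for the trigonometric polynomial with terms
   [c * echar k]. *)
Definition ev (T : list (C * (Z * Z))) (x : R * R) : C :=
  csum (fun p => fst p * echar (snd p) x)%C T.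

(** Frequencies may repeat in the list, as they do in products, so the coefficient is a sum over all
    occurrences. *)
Definition coef (T : list (C * (Z * Z))) (K : Z * Z) : C :=
  csum (fun p => fst p * indic (snd p) K)%C T.

(** [W] depends only on the possible frequencies and not on [T]. The same sampling points thus serve
    at all times, which makes the coefficients differentiable in time. *)
Lemma sampling_coef (l : list (Z * Z)) (K : Z * Z) :
  exists W : list (C * (R * R)), forall T, (forall p, In p T -> In (snd p) l) ->
    coef T K = csum (fun w => fst w * ev T (snd w))%C W.
Proof.
destruct (sampling l K) as [W HW]. exists W. intros T HT.
unfold ev. rewrite (csum_ext (fun w => fst w * csum _ T)%C
  (fun w => csum (fun p => fst w * (fst p * echar (snd p) (snd w))) T)%C)
  by (intros; now rewrite csum_scal).
rewrite csum_exchange. apply csum_ext; intros p Hp.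
rewrite <- (HW (snd p)) by now apply HT.
rewrite <- csum_scal. apply csum_ext; intros; ring.
Qed.

(** Sampling weights chosen for the frequencies of both lists express the two coefficients by the
    same combination of values. *)
Lemma coef_unique (T U : list (C * (Z * Z))) :
  (forall x, ev T x = ev U x) -> forall K, coef T K = coef U K.
Proof.
intros H K. destruct (sampling_coef (map snd (T ++ U)) K) as [W HW].
rewrite !HW.
- apply csum_ext; intros; now rewrite H.
- intros p Hp; apply in_map, in_or_app; now right.
- intros p Hp; apply in_map, in_or_app; now left.
Qed.

Definition tpoly (S : list (Z * Z)) (c : Z * Z -> C) : list (C * (Z * Z)) :=
  map (fun k => (c k, k)) S.

Lemma coef_tpoly (S : list (Z * Z)) (c : Z * Z -> C) (K : Z * Z) :
  NoDup S -> (~ In K S -> c K = RtoC 0) -> coef (tpoly S c) K = c K.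
Proof.
intros HS Hc. unfold coef, tpoly; rewrite csum_map; simpl.
destruct (in_dec keq_dec K S) as [HK|HK].
- rewrite (csum_single _ _ K HS HK).
  + unfold indic; destruct (keq_dec K K); [ring|easy].
  + intros y _ Hy; unfold indic; destruct (keq_dec y K); [easy|ring].
- rewrite Hc by easy. apply csum_zero; intros y Hy.
  unfold indic; destruct (keq_dec y K); [congruence|ring].
Qed.

Definition tmul (T U : list (C * (Z * Z))) : list (C * (Z * Z)) :=
  map (fun pq => (fst (fst pq) * fst (snd pq), kadd (snd (fst pq)) (snd (snd pq)))%C)
    (list_prod T U).

Lemma ev_app (T U : list (C * (Z * Z))) (x : R * R) : ev (T ++ U) x = (ev T x + ev U x)%C.
Proof. apply csum_app. Qed.

Lemma coef_app (T U : list (C * (Z * Z))) (K : Z * Z) :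
  coef (T ++ U) K = (coef T K + coef U K)%C.
Proof. apply csum_app. Qed.

Lemma ev_tmul (T U : list (C * (Z * Z))) (x : R * R) : ev (tmul T U) x = (ev T x * ev U x)%C.
Proof.
unfold ev, tmul. rewrite csum_map; cbn [fst snd].
rewrite (csum_prod (fun p q => fst p * fst q * echar (kadd (snd p) (snd q)) x)%C).
rewrite Cmult_comm, <- csum_scal. apply csum_ext; intros p _.
rewrite Cmult_comm, <- csum_scal. apply csum_ext; intros q _.
rewrite echar_kadd; ring.
Qed.

Lemma coef_tmul_tpoly (S : list (Z * Z)) (c d : Z * Z -> C) (K : Z * Z) :
  coef (tmul (tpoly S c) (tpoly S d)) K =
  csum (fun p => c (fst p) * d (snd p) * indic (kadd (fst p) (snd p)) K)%C (list_prod S S).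
Proof.
unfold coef, tmul, tpoly. rewrite csum_map; cbn [fst snd].
rewrite (csum_prod (fun p q => fst p * fst q * indic (kadd (snd p) (snd q)) K)%C).
rewrite (csum_prod (fun k l => c k * d l * indic (kadd k l) K)%C).
rewrite csum_map. apply csum_ext; intros; now rewrite csum_map.
Qed.

(* [tdiff1] and [tdiff2] are the partial derivatives divided by [i]. *)
Definition tdiff1 (T : list (C * (Z * Z))) : list (C * (Z * Z)) :=
  map (fun p => (RtoC (IZR (fst (snd p))) * fst p, snd p)%C) T.
Definition tdiff2 (T : list (C * (Z * Z))) : list (C * (Z * Z)) :=
  map (fun p => (RtoC (IZR (snd (snd p))) * fst p, snd p)%C) T.

Definition tscal (c : C) (T : list (C * (Z * Z))) : list (C * (Z * Z)) :=
  map (fun p => (c * fst p, snd p)%C) T.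

Lemma ev_tscal (c : C) (T : list (C * (Z * Z))) (x : R * R) :
  ev (tscal c T) x = (c * ev T x)%C.
Proof.
unfold ev, tscal; rewrite csum_map, <- csum_scal; apply csum_ext; intros; simpl; ring.
Qed.

Lemma coef_tscal (c : C) (T : list (C * (Z * Z))) (K : Z * Z) :
  coef (tscal c T) K = (c * coef T K)%C.
Proof.
unfold coef, tscal; rewrite csum_map, <- csum_scal; apply csum_ext; intros; simpl; ring.
Qed.

Lemma coef_tdiff1 (T : list (C * (Z * Z))) (K : Z * Z) :
  coef (tdiff1 T) K = (RtoC (IZR (fst K)) * coef T K)%C.
Proof.
unfold coef, tdiff1; rewrite csum_map, <- csum_scal; apply csum_ext; intros [c k] _.
unfold indic; simpl. destruct (keq_dec k K) as [->|]; ring.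
Qed.

Lemma coef_tdiff2 (T : list (C * (Z * Z))) (K : Z * Z) :
  coef (tdiff2 T) K = (RtoC (IZR (snd K)) * coef T K)%C.
Proof.
unfold coef, tdiff2; rewrite csum_map, <- csum_scal; apply csum_ext; intros [c k] _.
unfold indic; simpl. destruct (keq_dec k K) as [->|]; ring.
Qed.

Lemma tdiff1_tpoly (S : list (Z * Z)) (c : Z * Z -> C) :
  tdiff1 (tpoly S c) = tpoly S (fun k => RtoC (IZR (fst k)) * c k)%C.
Proof. unfold tdiff1, tpoly; now rewrite map_map. Qed.

Lemma tdiff2_tpoly (S : list (Z * Z)) (c : Z * Z -> C) :
  tdiff2 (tpoly S c) = tpoly S (fun k => RtoC (IZR (snd k)) * c k)%C.
Proof. unfold tdiff2, tpoly; now rewrite map_map. Qed.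

(** * Derivatives of complex-valued functions *)

Definition cderiv (f : R -> C) (t : R) (l : C) : Prop :=
  is_derive (fun s => fst (f s)) t (fst l) /\ is_derive (fun s => snd (f s)) t (snd l).

Lemma cderiv_unique (f : R -> C) (t : R) (l m : C) : cderiv f t l -> cderiv f t m -> l = m.
Proof.
intros [H1 H2] [H3 H4]. rewrite (surjective_pairing l), (surjective_pairing m); f_equal.
- now rewrite <- (is_derive_unique _ _ _ H1), <- (is_derive_unique _ _ _ H3).
- now rewrite <- (is_derive_unique _ _ _ H2), <- (is_derive_unique _ _ _ H4).
Qed.

Lemma cderiv_ext_loc (f g : R -> C) (t : R) (l : C) :
  locally t (fun s => f s = g s) -> cderiv f t l -> cderiv g t l.
Proof.
intros H [H1 H2]; split.
- eapply is_derive_ext_loc; [|exact H1]. revert H; apply filter_imp; now intros s ->.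
- eapply is_derive_ext_loc; [|exact H2]. revert H; apply filter_imp; now intros s ->.
Qed.

Lemma cderiv_const (c : C) (t : R) : cderiv (fun _ => c) t (RtoC 0).
Proof. split; apply (is_derive_const (V := R_NormedModule)). Qed.

Lemma cderiv_plus (f g : R -> C) (t : R) (l m : C) :
  cderiv f t l -> cderiv g t m -> cderiv (fun s => f s + g s)%C t (l + m)%C.
Proof. intros [H1 H2] [H3 H4]; split; now apply (is_derive_plus (V := R_NormedModule)). Qed.

Lemma cderiv_scal (c : C) (f : R -> C) (t : R) (l : C) :
  cderiv f t l -> cderiv (fun s => c * f s)%C t (c * l)%C.
Proof.
intros [H1 H2]; split; simpl.
- apply (is_derive_minus (V := R_NormedModule)); now apply is_derive_scal.
- apply (is_derive_plus (V := R_NormedModule)); now apply is_derive_scal.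
Qed.

Lemma cderiv_csum {T : Type} (f : T -> R -> C) (d : T -> C) (L : list T) (t : R) :
  (forall x, In x L -> cderiv (f x) t (d x)) ->
  cderiv (fun s => csum (fun x => f x s) L) t (csum d L).
Proof.
induction L as [|x L IH]; intros H; simpl; [apply cderiv_const|].
apply cderiv_plus; [apply H; now left|]. apply IH; intros; apply H; now right.
Qed.

Lemma cderiv_real (f : R -> R) (t : R) : ex_derive f t ->
  cderiv (fun s => RtoC (f s)) t (RtoC (Derive f t)).
Proof.
intros H; split; simpl; [now apply Derive_correct|].
apply (is_derive_const (V := R_NormedModule)).
Qed.

(** The imaginary part of the function is constantly 0, hence so is that of its derivative. This
    turns formulas with complex exponentials into real derivatives. *)
Lemma cderiv_real_inv (f : R -> R) (t : R) (l : C) :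
  cderiv (fun s => RtoC (f s)) t l -> is_derive f t (fst l) /\ l = RtoC (Derive f t).
Proof.
intros [H1 H2]. simpl in *. split; [easy|].
unfold RtoC; rewrite (surjective_pairing l); f_equal.
- symmetry; now apply is_derive_unique.
- rewrite <- (is_derive_unique _ _ _ H2). apply Derive_const.
Qed.

Lemma cderiv_expi (a b t : R) :
  cderiv (fun s => expi (a * s + b)) t (Ci * (RtoC a * expi (a * t + b)))%C.
Proof.
split; simpl; auto_derive; try easy; ring.
Qed.

Lemma cderiv_ev1 (T : list (C * (Z * Z))) (x1 x2 : R) :
  cderiv (fun s => ev T (s, x2)) x1 (Ci * ev (tdiff1 T) (x1, x2))%C.
Proof.
unfold ev, tdiff1. rewrite csum_map, <- csum_scal.
apply (cderiv_csum (fun p s => fst p * echar (snd p) (s, x2))%C). intros p _.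
eapply eq_ind; [apply cderiv_scal, (cderiv_expi (IZR (fst (snd p))) (IZR (snd (snd p)) * x2))|].
unfold echar, dotZ; cbn [fst snd]; ring.
Qed.

Lemma cderiv_ev2 (T : list (C * (Z * Z))) (x1 x2 : R) :
  cderiv (fun s => ev T (x1, s)) x2 (Ci * ev (tdiff2 T) (x1, x2))%C.
Proof.
unfold ev, tdiff2. rewrite csum_map, <- csum_scal.
apply (cderiv_csum (fun p s => fst p * echar (snd p) (x1, s))%C). intros p _.
eapply eq_ind.
- apply cderiv_scal. eapply cderiv_ext_loc; [|apply (cderiv_expi (IZR (snd (snd p))) (IZR (fst (snd p)) * x1))].
  apply filter_forall; intros s. unfold echar, dotZ; cbn [fst snd]. f_equal; ring.
- unfold echar, dotZ; cbn [fst snd]. rewrite (Rplus_comm (IZR (fst _) * _)). ring.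
Qed.

Lemma ccont_ev (T : list (C * (Z * Z))) : ccont (ev T).
Proof.
induction T as [|p T IH]; [apply ccont_const|].
apply (ccont_plus (fun x => fst p * echar (snd p) x)%C (ev T)); [|exact IH].
apply (ccont_mult (fun _ => fst p) (echar (snd p))); [apply ccont_const|apply ccont_char].
Qed.

Lemma ev_on_torus (T : list (C * (Z * Z))) : on_torus (ev T).
Proof.
intros x1 x2; split; apply csum_ext; intros p _; f_equal; unfold echar, dotZ; cbn [fst snd].
- replace (IZR (fst (snd p)) * (x1 + 2 * PI) + IZR (snd (snd p)) * x2) with
   ((IZR (fst (snd p)) * x1 + IZR (snd (snd p)) * x2) + IZR (fst (snd p)) * (2 * PI)) by ring.
  rewrite expi_plus, expi_2PI; ring.
- replace (IZR (fst (snd p)) * x1 + IZR (snd (snd p)) * (x2 + 2 * PI)) with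
   ((IZR (fst (snd p)) * x1 + IZR (snd (snd p)) * x2) + IZR (snd (snd p)) * (2 * PI)) by ring.
  rewrite expi_plus, expi_2PI; ring.
Qed.

(** * Fourier integrals of trigonometric polynomials and inversion *)

Lemma cfourier_plus (F G : R * R -> C) (k : Z * Z) : ccont F -> ccont G ->
  cfourier (fun x => F x + G x)%C k = (cfourier F k + cfourier G k)%C.
Proof.
intros CF CG. unfold cfourier.
assert (C1 : ccont (fun x => F x * expi (- dotZ k x))%C)
  by (apply ccont_mult; [easy|apply ccont_char_opp]).
assert (C2 : ccont (fun x => G x * expi (- dotZ k x))%C)
  by (apply ccont_mult; [easy|apply ccont_char_opp]).
rewrite <- cint_plus by first [exact (ccont_cint_param _ C1)|exact (ccont_cint_param _ C2)].
apply cint_ext; intros x1.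
rewrite <- cint_plus by first [exact (ccont_slice_r _ x1 C1)|exact (ccont_slice_r _ x1 C2)].
apply cint_ext; intros x2. ring.
Qed.

Lemma cfourier_scal (c : C) (F : R * R -> C) (k : Z * Z) : ccont F ->
  cfourier (fun x => c * F x)%C k = (c * cfourier F k)%C.
Proof.
intros CF. unfold cfourier.
assert (C1 : ccont (fun x => F x * expi (- dotZ k x))%C)
  by (apply ccont_mult; [easy|apply ccont_char_opp]).
rewrite <- cint_scal by exact (ccont_cint_param _ C1).
apply cint_ext; intros x1.
rewrite <- cint_scal by exact (ccont_slice_r _ x1 C1).
apply cint_ext; intros x2. ring.
Qed.

Lemma cfourier_echar (k l : Z * Z) :
  cfourier (echar l) k = (RtoC ((2 * PI) ^ 2) * indic l k)%C.
Proof.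
assert (E : cfourier (echar l) k =
  (cint (fun x => expi (IZR (snd l - snd k) * x)) * cint (fun x => expi (IZR (fst l - fst k) * x)))%C).
{ rewrite <- cint_scal by apply ccont_expi_lin. apply cint_ext; intros x1.
  rewrite Cmult_comm, <- cint_scal by apply ccont_expi_lin. apply cint_ext; intros x2.
  unfold echar. rewrite <- !expi_plus; f_equal. unfold dotZ; simpl.
  rewrite !minus_IZR; ring. }
rewrite E, !cint_expi. destruct k as [k1 k2], l as [l1 l2]; cbn [fst snd]. unfold indic.
destruct (keq_dec (l1, l2) (k1, k2)) as [H|H].
- injection H as -> ->. rewrite !Z.sub_diag; simpl. rewrite <- RtoC_mult, Cmult_1_r. f_equal; ring.
- destruct (Z.eq_dec (l2 - k2) 0); destruct (Z.eq_dec (l1 - k1) 0); try ring.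
  destruct H; f_equal; lia.
Qed.

Lemma cfourier_ev (T : list (C * (Z * Z))) (k : Z * Z) :
  cfourier (ev T) k = (RtoC ((2 * PI) ^ 2) * coef T k)%C.
Proof.
induction T as [|p T IH].
- unfold coef; simpl. rewrite Cmult_0_r. rewrite <- cint_zero. apply cint_ext; intros x1.
  rewrite <- cint_zero at 1. apply cint_ext; intros x2. unfold ev; simpl. ring.
- change (ev (p :: T)) with (fun x => fst p * echar (snd p) x + ev T x)%C.
  rewrite cfourier_plus; [|apply (ccont_mult (fun _ => fst p) (echar (snd p))); [apply ccont_const|apply ccont_char]|apply ccont_ev].
  rewrite cfourier_scal by apply ccont_char.
  rewrite IH, cfourier_echar. unfold coef; simpl. ring.
Qed.

(** No convergence is involved: [F] minus the finite sum is continuous and all its coefficients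
    vanish, so [cfourier_injective] applies. *)
Lemma fourier_inversion (F : R * R -> C) (S : list (Z * Z)) :
  ccont F -> on_torus F -> NoDup S -> (forall k, ~ In k S -> cfourier F k = RtoC 0) ->
  forall x, F x = ev (tpoly S (fun k => cfourier F k / RtoC ((2 * PI) ^ 2))%C) x.
Proof.
intros CF PF HS HF x.
pose proof PI_RGT_0.
assert (Hpi : RtoC ((2 * PI) ^ 2) <> RtoC 0).
{ intros E; injection E; intros E'. assert (0 < 2 * PI) by lra. nra. }
set (T := tpoly S _).
assert (Z0 : (F x + Copp (RtoC 1) * ev T x)%C = RtoC 0).
{ apply (cfourier_injective (fun x => F x + Copp (RtoC 1) * ev T x)%C).
  - apply ccont_plus; [easy|].
    apply (ccont_mult (fun _ => Copp (RtoC 1)) (ev T)); [apply ccont_const|apply ccont_ev].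
  - intros x1 x2. destruct (PF x1 x2) as [-> ->], (ev_on_torus T x1 x2) as [-> ->]; easy.
  - intros k. rewrite cfourier_plus; [|easy|].
    2:{ apply (ccont_mult (fun _ => Copp (RtoC 1)) (ev T)); [apply ccont_const|apply ccont_ev]. }
    rewrite cfourier_scal by apply ccont_ev. rewrite cfourier_ev.
    unfold T; rewrite coef_tpoly; [|easy|].
    + field; easy.
    + intros Hk; rewrite HF by easy. unfold Cdiv; ring. }
replace (F x) with ((F x + Copp (RtoC 1) * ev T x) + ev T x)%C by ring.
rewrite Z0; ring.
Qed.

(** * Dynamics of finitely many modes *)

Definition Zc (n : Z) : C := RtoC (IZR n).

Lemma cderiv_continuous (f : R -> C) (t : R) (l : C) : cderiv f t l ->
  continuous (fun s => fst (f s)) t /\ continuous (fun s => snd (f s)) t.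
Proof. intros [H1 H2]; split; apply (ex_derive_continuous (V := R_NormedModule)); eexists; eassumption. Qed.

Lemma cderiv_locally_neq (f : R -> C) (t : R) (l c : C) :
  cderiv f t l -> f t <> c -> locally t (fun s => f s <> c).
Proof.
intros H Hc; destruct (cderiv_continuous _ _ _ H) as [H1 H2].
assert (N : forall (g : R -> R) y, continuous g t -> g t <> y -> locally t (fun s => g s <> y)).
{ intros g y Cg Hg. apply (Cg (fun z => z <> y)). now apply open_neq. }
destruct (Req_dec (fst (f t)) (fst c)) as [E1|E1].
- destruct (Req_dec (snd (f t)) (snd c)) as [E2|E2].
  + destruct Hc. rewrite (surjective_pairing (f t)), E1, E2; now destruct c.
  + generalize (N _ _ H2 E2); apply filter_imp; congruence.
- generalize (N _ _ H1 E1); apply filter_imp; congruence.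
Qed.

Lemma cderiv_zero_locally_constant (f : R -> C) (t : R) :
  locally t (fun s => cderiv f s (RtoC 0)) -> locally t (fun s => f s = f t).
Proof.
intros [e He]; exists e; intros s Hs.
assert (Q : forall a b, a < b -> (forall r, a <= r <= b -> cderiv f r (RtoC 0)) -> f a = f b).
{ intros a b Hab H. rewrite (surjective_pairing (f a)), (surjective_pairing (f b)); f_equal.
  - apply (eq_is_derive (V := R_NormedModule) (fun s => fst (f s))); [intros; now apply H|easy].
  - apply (eq_is_derive (V := R_NormedModule) (fun s => snd (f s))); [intros; now apply H|easy]. }
unfold ball in *; simpl in *. unfold AbsRing_ball, abs, minus, plus, opp in *; simpl in *.
apply Rabs_def2 in Hs.
destruct (Rtotal_order s t) as [H|[->|H]]; [|easy|].
- apply Q; [easy|]. intros r Hr; apply He, Rabs_def1; lra.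
- symmetry; apply Q; [easy|]. intros r Hr; apply He, Rabs_def1; lra.
Qed.

Lemma filter_forall_list {T U : Type} (F : (T -> Prop) -> Prop) {FF : Filter F}
  (P : U -> T -> Prop) (l : list U) :
  (forall k, F (P k)) -> F (fun s => forall k, In k l -> P k s).
Proof.
intros H; induction l as [|k l IH].
- now apply filter_forall.
- generalize (filter_and _ _ (H k) IH); apply filter_imp.
  intros s [H1 H2] j [<-|Hj]; [easy|now apply H2].
Qed.

(** A greedy choice, one mode at a time: if the mode is present at some remaining time, only such
    times are kept; otherwise it is absent from all of them. The result is maximal for inclusion. *)
Lemma exists_maximal_support {T U : Type} (Q : T -> U -> Prop) (l : list U) (I : T -> Prop) :
  (exists t, I t) -> exists t, I t /\ forall s, I s ->
    (forall k, In k l -> Q t k -> Q s k) -> forall k, In k l -> Q s k -> Q t k.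
Proof.
revert I; induction l as [|j l IH]; intros I [t0 Ht0].
- exists t0; split; [easy|]. now intros.
- destruct (classic (exists t, I t /\ Q t j)) as [[t1 Ht1]|H].
  + destruct (IH (fun t => I t /\ Q t j)) as [t [[It Qt] Ht]]; [now exists t1|].
    exists t; split; [easy|]. intros s Is Hs k [<-|Hk]; [easy|].
    apply Ht; [split; [easy|apply Hs; [now left|easy]]| |easy].
    intros; apply Hs; [now right|easy].
  + destruct (IH I) as [t [It Ht]]; [now exists t0|].
    exists t; split; [easy|]. intros s Is Hs k [<-|Hk] Qs; [now destruct H; exists s|].
    apply (Ht s); try easy. intros; apply Hs; [now right|easy].
Qed.

Lemma in_interval_locally (t1 t2 : Rbar) (t : R) :
  in_interval t1 t2 t -> locally t (in_interval t1 t2).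
Proof. intros [H1 H2]. apply (locally_interval _ t t1 t2 H1 H2). now split. Qed.

Lemma in_interval_nonempty (t1 t2 : Rbar) : Rbar_lt t1 t2 -> exists t, in_interval t1 t2 t.
Proof.
intros H; destruct t1 as [a| |], t2 as [b| |]; try easy.
- simpl in H. exists ((a + b) / 2); split; simpl; lra.
- exists (a + 1); split; simpl; [lra|easy].
- exists (b - 1); split; simpl; [easy|lra].
- exists 0; now split.
Qed.

Definition rigid_support (A : Z * Z -> Prop) : Prop :=
  (exists a, a <> (0, 0)%Z /\ forall k, A k -> kdet a k = 0%Z) \/
  (exists N, (0 < N)%Z /\ forall k, A k -> kdot k k = N).

Definition interaction (l m : Z * Z) : C := Zc (kdet l m * (kdot m m - kdot l l)).

Lemma Zc_eq_0 (n : Z) : Zc n = RtoC 0 -> n = 0%Z.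
Proof. intros H; injection H; apply eq_IZR. Qed.

Lemma interaction_swap (l m : Z * Z) : interaction m l = interaction l m.
Proof. unfold interaction; f_equal; unfold kdet; ring. Qed.

(** For $k \neq l$ only the terms $(k, l)$ and $(l, k)$ survive. They are equal by symmetry of
    [interaction], so twice [interaction k l] times nonzero coefficients vanishes. *)
Lemma isolated_pair_of_stationary_mode (S : list (Z * Z)) (a : Z * Z -> C) (k l : Z * Z) :
  NoDup S -> (forall m, ~ In m S -> a m = RtoC 0) ->
  a k <> RtoC 0 -> a l <> RtoC 0 ->
  csum (fun p => interaction (fst p) (snd p) * (a (fst p) * a (snd p)) *
          indic (kadd (fst p) (snd p)) (kadd k l))%C (list_prod S S) = RtoC 0 ->
  (forall c d, a c <> RtoC 0 -> a d <> RtoC 0 -> kadd c d = kadd k l ->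
     kdet c d = 0%Z \/ kdot c c = kdot d d \/ c = k \/ c = l) ->
  kdet k l = 0%Z \/ kdot k k = kdot l l.
Proof.
intros HS Ha Hk Hl Hsum Hiso.
assert (inS : forall m, a m <> RtoC 0 -> In m S).
{ intros m Hm; apply NNPP; intro; now apply Hm, Ha. }
destruct (keq_dec k l) as [->|Hkl]; [now right|].
rewrite (csum_two _ _ (k, l) (l, k)) in Hsum.
- cbn [fst snd] in Hsum. rewrite (interaction_swap k l) in Hsum. unfold indic in Hsum.
  destruct (keq_dec (kadd k l) (kadd k l)) as [_|]; [|easy].
  destruct (keq_dec (kadd l k) (kadd k l)) as [_|H].
  2:{ destruct H; unfold kadd; f_equal; ring. }
  assert (E : (interaction k l * (RtoC 2 * a k * a l))%C = RtoC 0).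
  { rewrite <- Hsum. replace (RtoC 2) with (RtoC 1 + RtoC 1)%C by (rewrite <- RtoC_plus; f_equal; ring). ring. }
  assert (N : (RtoC 2 * a k * a l)%C <> RtoC 0).
  { repeat apply Cmult_neq_0; try easy. intros H; injection H; lra. }
  assert (I0 : interaction k l = RtoC 0).
  { apply NNPP; intros H; now apply (Cmult_neq_0 _ _ H N). }
  apply Zc_eq_0 in I0. apply Zmult_integral in I0. destruct I0; [now left|right; lia].
- now apply NoDup_list_prod.
- apply in_prod; now apply inS.
- apply in_prod; now apply inS.
- congruence.
- intros [c d] _ H1 H2; cbn [fst snd].
  destruct (classic (a c = RtoC 0)) as [->|Hc]; [ring|].
  destruct (classic (a d = RtoC 0)) as [->|Hd]; [ring|].
  unfold indic; destruct (keq_dec (kadd c d) (kadd k l)) as [E|]; [|ring].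
  assert (I0 : interaction c d = RtoC 0).
  { unfold interaction, Zc. destruct (Hiso c d Hc Hd E) as [->|[->|[->| ->]]].
    - now rewrite Z.mul_0_l.
    - now rewrite Z.sub_diag, Z.mul_0_r.
    - destruct H1; f_equal. destruct d, l; unfold kadd in E; simpl in E.
      injection E; intros; f_equal; lia.
    - destruct H2; f_equal. destruct d, k; unfold kadd in E; simpl in E.
      injection E; intros; f_equal; lia. }
  rewrite I0; ring.
Qed.

Lemma interaction_sum_rigid (S : list (Z * Z)) (a : Z * Z -> C) (K : Z * Z) :
  rigid_support (fun k => a k <> RtoC 0) ->
  csum (fun p => interaction (fst p) (snd p) * (a (fst p) * a (snd p)) *
          indic (kadd (fst p) (snd p)) K)%C (list_prod S S) = RtoC 0.
Proof.
intros HR; apply csum_zero; intros [c d] _; cbn [fst snd].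
destruct (classic (a c = RtoC 0)) as [->|Hc]; [ring|].
destruct (classic (a d = RtoC 0)) as [->|Hd]; [ring|].
assert (I0 : interaction c d = RtoC 0).
{ unfold interaction, Zc. destruct HR as [[b [Hb HR]]|[N [HN HR]]].
  - specialize (HR c Hc) as H1; specialize (HR d Hd) as H2.
    assert (E := kdot_pos b Hb).
    assert (G : (kdot b b * kdet c d = kdot b c * kdet b d - kdet b c * kdot b d)%Z)
        by (unfold kdet, kdot; ring).
    rewrite H1, H2, Z.mul_0_r, Z.mul_0_l in G.
    assert (kdet c d = 0%Z) as -> by nia. now rewrite Z.mul_0_l.
  - rewrite (HR c Hc), (HR d Hd), Z.sub_diag, Z.mul_0_r; easy. }
rewrite I0; ring.
Qed.

(* Near a time of maximal support the support is constant, so every mode outside it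
   is stationary there. *)
Lemma finite_mode_dynamics_trivial (t1 t2 : Rbar) (S : list (Z * Z))
  (a b : R -> Z * Z -> C) :
  Rbar_lt t1 t2 -> NoDup S ->
  (forall t k, in_interval t1 t2 t -> cderiv (fun s => a s k) t (b t k)) ->
  (forall t k, in_interval t1 t2 t -> ~ In k S -> a t k = RtoC 0) ->
  (forall t k, in_interval t1 t2 t -> a t k <> RtoC 0 -> a t (kopp k) <> RtoC 0) ->
  (forall t, in_interval t1 t2 t -> a t (0, 0)%Z = RtoC 0) ->
  (forall t K, in_interval t1 t2 t ->
     (RtoC 2 * Zc (kdot K K) * b t K + Ci *
      csum (fun p => interaction (fst p) (snd p) * (a t (fst p) * a t (snd p)) *
          indic (kadd (fst p) (snd p)) K)%C (list_prod S S))%C = RtoC 0) ->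
  exists A, rigid_support A /\
    (forall t k, in_interval t1 t2 t -> a t k <> RtoC 0 -> A k) /\
    (forall s t k, in_interval t1 t2 s -> in_interval t1 t2 t -> a s k = a t k).
Proof.
intros Ht HS Hab Hsupp Hopp H0 Heq.
set (I := in_interval t1 t2) in *.
set (Q := fun t k => a t k <> RtoC 0).
destruct (exists_maximal_support Q S I) as [t0 [It0 Hmax0]].
{ now apply in_interval_nonempty. }
assert (QS : forall t k, I t -> Q t k -> In k S).
{ intros t k It Hk; apply NNPP; intro; now apply Hk, Hsupp. }
set (Max := fun t => I t /\ forall s, I s ->
    (forall k, In k S -> Q t k -> Q s k) -> forall k, In k S -> Q s k -> Q t k).
assert (Hloc : forall t, Max t -> locally t (fun s => I s /\ forall k, Q s k <-> Q t k)).
{ intros t [It Hm].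
  (* By continuity nonzero modes persist, so nearby supports contain that at [t]; maximality gives
     the converse inclusion. *)
  assert (L1 : locally t (fun s => forall k, In k S -> Q t k -> Q s k)).
  { apply filter_forall_list; [apply locally_filter|]. intros k.
    destruct (classic (Q t k)) as [Hk|Hk].
    - generalize (cderiv_locally_neq _ _ _ _ (Hab t k It) Hk); now apply filter_imp.
    - now apply filter_forall. }
  generalize (filter_and _ _ (in_interval_locally _ _ _ It) L1); apply filter_imp.
  intros s [Is Hs]; split; [easy|]. intros k; split; intros Hk.
  - apply (Hm s Is Hs); [now apply (QS s)|easy].
  - apply Hs; [now apply (QS t)|easy]. }
assert (HR : forall t, Max t -> rigid_support (Q t)).
{ intros t Mt. assert (It := proj1 Mt).
  assert (Hst : forall K, ~ Q t K -> b t K = RtoC 0).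
  { intros K HK. apply (cderiv_unique (fun s => a s K) t); [now apply Hab|].
    eapply cderiv_ext_loc; [|apply (cderiv_const (RtoC 0))].
    generalize (Hloc t Mt); apply filter_imp. intros s [_ Hs].
    symmetry; apply NNPP; intros H; now apply HK, Hs. }
  apply (support_rigidity (Q t) S).
  - intros k; now apply QS.
  - intros k; now apply Hopp.
  - intros H; now apply H, H0.
  - intros k l Hk Hl Hkl Hiso.
    apply (isolated_pair_of_stationary_mode S (a t)); try easy.
    + intros m Hm; now apply Hsupp.
    + specialize (Heq t (kadd k l) It). rewrite Hst, Cmult_0_r, Cplus_0_l in Heq by easy.
      apply NNPP; intros H. revert Heq. apply Cmult_neq_0; [|exact H].
      intros E; injection E; lra. }
(* The equation yields [b t K] only through division by $|K|^2$; mode 0 is instead constant by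
   [H0]. *)
assert (Hb : forall t K, I t -> rigid_support (Q t) -> b t K = RtoC 0).
{ intros t K It Rt. destruct (keq_dec K (0, 0)%Z) as [->|HK].
  - apply (cderiv_unique (fun s => a s (0, 0)%Z) t); [now apply Hab|].
    eapply cderiv_ext_loc; [|apply (cderiv_const (RtoC 0))].
    generalize (in_interval_locally _ _ _ It); apply filter_imp. intros s Is.
    symmetry; now apply H0.
  - specialize (Heq t K It). rewrite interaction_sum_rigid, Cmult_0_r, Cplus_0_r in Heq by easy.
    apply NNPP; intros H. revert Heq. repeat apply Cmult_neq_0; [intros E; injection E; lra| |easy].
    intros E; apply Zc_eq_0 in E. apply kdot_pos in HK; lia. }
assert (Hconst : forall t, Max t -> locally t (fun s => forall k, a s k = a t k)).
{ intros t Mt.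
  assert (L : forall k, locally t (fun s => a s k = a t k)).
  { intros k. apply (cderiv_zero_locally_constant (fun s => a s k)).
    generalize (Hloc t Mt); apply filter_imp. intros s [Is Hs].
    rewrite <- (Hb s k Is); [now apply Hab|].
    destruct (HR t Mt) as [[c [Hc R]]|[N [HN R]]]; [left|right].
    - exists c; split; [easy|]. intros j Hj; now apply R, Hs.
    - exists N; split; [easy|]. intros j Hj; now apply R, Hs. }
  assert (LS := filter_forall_list (locally t) _ S L).
  generalize (filter_and _ _ (in_interval_locally _ _ _ (proj1 Mt)) LS); apply filter_imp.
  intros s [Is Hs] k. destruct (in_dec keq_dec k S) as [Hk|Hk]; [now apply Hs|].
  rewrite !Hsupp; try easy. apply Mt. }
assert (Hglob : forall t, I t -> forall k, a t k = a t0 k).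
{ set (P := fun t => forall k, a t k = a t0 k).
  (* Connectedness via calculus: [P] and its complement are both open in time, so their 0/1
     indicator has zero derivative on the interval and is constant there. *)
  set (g := fun t => if excluded_middle_informative (P t) then 1 else 0).
  assert (Dg : forall t, I t -> is_derive g t 0).
  { intros t It.
    apply (is_derive_ext_loc (fun _ => g t)); [|apply (is_derive_const (V := R_NormedModule))].
    unfold g; destruct (excluded_middle_informative (P t)) as [Pt|NPt].
    (* Where [P] holds, the support is that at [t0], hence again maximal, and [Hconst] applies. *)
    - assert (Mt : Max t).
      { split; [easy|]. intros s Is Hs k Hk Qs. unfold Q. rewrite Pt.
        apply (Hmax0 s Is); try easy. intros j Hj Qj. apply Hs; [easy|]. unfold Q; now rewrite Pt. }
      generalize (Hconst t Mt); apply filter_imp. intros s Hs.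
      destruct (excluded_middle_informative (P s)) as [|NPs]; [easy|].
      destruct NPs; intros k; now rewrite Hs.
    - apply not_all_ex_not in NPt; destruct NPt as [k Hk].
      generalize (cderiv_locally_neq _ _ _ _ (Hab t k It) Hk); apply filter_imp. intros s Hs.
      destruct (excluded_middle_informative (P s)) as [Ps|]; [|easy]. now destruct Hs. }
  assert (between : forall x y z, I x -> I z -> x <= y <= z -> I y).
  { intros x y z [H1 _] [_ H2] Hy; split.
    - eapply Rbar_lt_le_trans; [exact H1|simpl; lra].
    - eapply Rbar_le_lt_trans; [|exact H2]; simpl; lra. }
  intros t It. change (P t).
  assert (G : g t = g t0).
  { destruct (Rtotal_order t t0) as [H|[->|H]]; [|easy|].
    - apply (eq_is_derive (V := R_NormedModule)); [|easy].
      intros y Hy; apply Dg; now apply (between t y t0).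
    - symmetry. apply (eq_is_derive (V := R_NormedModule)); [|easy].
      intros y Hy; apply Dg; now apply (between t0 y t). }
  unfold g in G. destruct (excluded_middle_informative (P t)); [easy|].
  destruct (excluded_middle_informative (P t0)) as [|N]; [lra|]. now destruct N. }
exists (Q t0). split; [|split].
- apply HR; now split.
- intros t k It Hk. unfold Q; now rewrite <- (Hglob t It).
- intros s t k Is It. now rewrite (Hglob s Is), (Hglob t It).
Qed.

(** * From the Euler equation to the stream function *)

Lemma ex_derive_slices (p : R * R -> R) (x : R * R) :
  ex_filterdiff (K := R_AbsRing) p (locally x) ->
  ex_derive (fun s => p (s, snd x)) (fst x) /\ ex_derive (fun s => p (fst x, s)) (snd x).
Proof.
destruct x as [x1 x2]; simpl; intros H.
split; apply ex_derive_filterdiff.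
- apply (ex_filterdiff_comp'_2 (fun s => s) (fun _ => x2) (fun a b => p (a, b))).
  + apply ex_filterdiff_id.
  + apply ex_filterdiff_const.
  + eapply ex_filterdiff_ext; [|exact H]. now intros [].
- apply (ex_filterdiff_comp'_2 (fun _ => x1) (fun s => s) (fun a b => p (a, b))).
  + apply ex_filterdiff_const.
  + apply ex_filterdiff_id.
  + eapply ex_filterdiff_ext; [|exact H]. now intros [].
Qed.

Lemma partials_of_ev (f : R * R -> R) (T : list (C * (Z * Z))) :
  (forall x, RtoC (f x) = ev T x) -> forall x1 x2 : R,
  is_derive (fun s => f (s, x2)) x1 (fst (Ci * ev (tdiff1 T) (x1, x2))%C) /\
  is_derive (fun s => f (x1, s)) x2 (fst (Ci * ev (tdiff2 T) (x1, x2))%C) /\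
  RtoC (partial1 f (x1, x2)) = (Ci * ev (tdiff1 T) (x1, x2))%C /\
  RtoC (partial2 f (x1, x2)) = (Ci * ev (tdiff2 T) (x1, x2))%C.
Proof.
intros H x1 x2.
destruct (cderiv_real_inv (fun s => f (s, x2)) x1 (Ci * ev (tdiff1 T) (x1, x2))%C) as [H1 H2].
{ eapply cderiv_ext_loc; [|apply cderiv_ev1]. apply filter_forall; intros s; now rewrite H. }
destruct (cderiv_real_inv (fun s => f (x1, s)) x2 (Ci * ev (tdiff2 T) (x1, x2))%C) as [H3 H4].
{ eapply cderiv_ext_loc; [|apply cderiv_ev2]. apply filter_forall; intros s; now rewrite H. }
split; [exact H1|split; [exact H3|split; symmetry; [exact H2|exact H4]]].
Qed.

(** Only differentiability of [p] is assumed: the mixed second partials exist and are continuous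
    because the first partials are trigonometric polynomials. The identity is equality of mixed
    partials mode by mode, with [Ci] cancelled. *)
Lemma gradient_curl_free (p : R * R -> R) (G1 G2 : list (C * (Z * Z))) :
  (forall x, ex_filterdiff (K := R_AbsRing) p (locally x)) ->
  (forall x, RtoC (partial1 p x) = ev G1 x) ->
  (forall x, RtoC (partial2 p x) = ev G2 x) ->
  forall K, (RtoC (IZR (snd K)) * coef G1 K = RtoC (IZR (fst K)) * coef G2 K)%C.
Proof.
intros Hp H1 H2 K. rewrite <- coef_tdiff1, <- coef_tdiff2. apply coef_unique.
intros [x1 x2].
assert (D1 := partials_of_ev _ _ H1). assert (D2 := partials_of_ev _ _ H2).
assert (Sch : Derive (fun z => Derive (fun t => p (z, t)) x2) x1 =
              Derive (fun z => Derive (fun t => p (t, z)) x1) x2).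
{ assert (Cev : forall T x y, continuity_2d_pt (fun u v => fst (Ci * ev T (u, v))%C) x y).
  { intros T x y. apply continuity_2d_pt_filterlim.
    assert (CC : ccont (fun x => Ci * ev T x)%C).
    { apply (ccont_mult (fun _ => Ci) (ev T)); [apply ccont_const|apply ccont_ev]. }
    eapply filterlim_ext; [|apply (CC (x, y))]. now intros []. }
  apply (Schwarz (fun u v => p (u, v))).
  - exists (mkposreal 1 Rlt_0_1); intros u v _ _.
    destruct (ex_derive_slices p (u, v) (Hp (u, v))) as [E1 E2].
    destruct (D1 u v) as [_ [D12 _]]. destruct (D2 u v) as [D21 _].
    split; [exact E1|split; [exact E2|split]].
    + eexists; exact D21.
    + eexists; exact D12.
  - eapply continuity_2d_pt_ext; [|apply (Cev (tdiff1 G2))]. intros u v.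
    destruct (D2 u v) as [D21 _]. symmetry; exact (is_derive_unique _ _ _ D21).
  - eapply continuity_2d_pt_ext; [|apply (Cev (tdiff2 G1))]. intros u v.
    destruct (D1 u v) as [_ [D12 _]]. symmetry; exact (is_derive_unique _ _ _ D12). }
destruct (D1 x1 x2) as [_ [_ [_ E1]]]. destruct (D2 x1 x2) as [_ [_ [E2 _]]].
assert (E : (Ci * ev (tdiff2 G1) (x1, x2) = Ci * ev (tdiff1 G2) (x1, x2))%C).
{ rewrite <- E1, <- E2. f_equal. symmetry. exact Sch. }
assert (HCi : Ci <> RtoC 0) by (intros H; injection H; lra).
replace (ev (tdiff2 G1) (x1, x2)) with (/ Ci * (Ci * ev (tdiff2 G1) (x1, x2)))%C by (field; easy).
rewrite E; field; easy.
Qed.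

Lemma csum_prod_swap {T : Type} (f : T -> T -> C) (l : list T) :
  csum (fun p => f (fst p) (snd p)) (list_prod l l) =
  csum (fun p => f (snd p) (fst p)) (list_prod l l).
Proof.
rewrite (csum_prod f), (csum_prod (fun x y => f y x)). apply csum_exchange.
Qed.

Lemma divergence_free_modes (S : list (Z * Z)) (c1 c2 : Z * Z -> C) (v : R * R -> R * R) :
  NoDup S ->
  (forall k, ~ In k S -> c1 k = RtoC 0 /\ c2 k = RtoC 0) ->
  (forall x, RtoC (fst (v x)) = ev (tpoly S c1) x) ->
  (forall x, RtoC (snd (v x)) = ev (tpoly S c2) x) ->
  (forall x, divergence v x = 0) ->
  forall k, (Zc (fst k) * c1 k + Zc (snd k) * c2 k)%C = RtoC 0.
Proof.
intros HS Hc H1 H2 Hdiv k.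
assert (E : coef (tdiff1 (tpoly S c1) ++ tdiff2 (tpoly S c2)) k = coef nil k).
{ apply coef_unique; intros [x1 x2].
  destruct (partials_of_ev _ _ H1 x1 x2) as [_ [_ [E1 _]]].
  destruct (partials_of_ev _ _ H2 x1 x2) as [_ [_ [_ E2]]].
  specialize (Hdiv (x1, x2)). unfold divergence in Hdiv.
  apply (f_equal RtoC) in Hdiv. rewrite RtoC_plus, E1, E2 in Hdiv.
  assert (HCi : Ci <> RtoC 0) by (intros H; injection H; lra).
  rewrite ev_app.
  replace (ev (tdiff1 (tpoly S c1)) (x1, x2) + ev (tdiff2 (tpoly S c2)) (x1, x2))%C with
    (/ Ci * (Ci * ev (tdiff1 (tpoly S c1)) (x1, x2) + Ci * ev (tdiff2 (tpoly S c2)) (x1, x2)))%C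
    by (field; easy).
  rewrite Hdiv. unfold ev; simpl; ring. }
rewrite coef_app, coef_tdiff1, coef_tdiff2, !coef_tpoly in E; try easy.
- intros H; now apply Hc.
- intros H; now apply Hc.
Qed.

(* [a k] is [i] times the coefficient of the stream function; the interaction is
   symmetrized in the two interacting modes. *)
Lemma stream_equation (S : list (Z * Z)) (a b : Z * Z -> C)
  (v w : R * R -> R * R) (p : R * R -> R) :
  NoDup S ->
  (forall k, ~ In k S -> a k = RtoC 0) -> (forall k, ~ In k S -> b k = RtoC 0) ->
  (forall x, RtoC (fst (v x)) = ev (tpoly S (fun k => - (Zc (snd k) * a k))%C) x) ->
  (forall x, RtoC (snd (v x)) = ev (tpoly S (fun k => Zc (fst k) * a k)%C) x) ->
  (forall x, RtoC (fst (w x)) = ev (tpoly S (fun k => - (Zc (snd k) * b k))%C) x) ->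
  (forall x, RtoC (snd (w x)) = ev (tpoly S (fun k => Zc (fst k) * b k)%C) x) ->
  (forall x, ex_filterdiff (K := R_AbsRing) p (locally x)) ->
  (forall x, fst (w x) + advect v (fun y => fst (v y)) x + partial1 p x = 0) ->
  (forall x, snd (w x) + advect v (fun y => snd (v y)) x + partial2 p x = 0) ->
  forall K,
  (RtoC 2 * Zc (kdot K K) * b K + Ci *
      csum (fun q => interaction (fst q) (snd q) * (a (fst q) * a (snd q)) *
          indic (kadd (fst q) (snd q)) K)%C (list_prod S S))%C = RtoC 0.
Proof.
intros HS Ha Hb Hv1 Hv2 Hw1 Hw2 Hp Hm1 Hm2 K.
set (c1 := fun k => (- (Zc (snd k) * a k))%C) in *.
set (c2 := fun k => (Zc (fst k) * a k)%C) in *.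
set (d1 := fun k => (- (Zc (snd k) * b k))%C) in *.
set (d2 := fun k => (Zc (fst k) * b k)%C) in *.
(* The momentum equation solved for a pressure derivative; the inner [Ci] restores the factor left
   out by [tdiff1] and [tdiff2]. *)
set (G := fun c d : Z * Z -> C =>
  tscal (- RtoC 1)%C (tpoly S d ++
    tscal Ci (tmul (tpoly S c1) (tdiff1 (tpoly S c)) ++ tmul (tpoly S c2) (tdiff2 (tpoly S c))))).
assert (HG : forall (f : R * R -> R) (g q : R * R -> R) c d,
  (forall x, RtoC (f x) = ev (tpoly S c) x) -> (forall x, RtoC (g x) = ev (tpoly S d) x) ->
  (forall x, g x + advect v f x + q x = 0) -> forall x, RtoC (q x) = ev (G c d) x).
{ intros f g q c d Hf Hg Hq [x1 x2].
  destruct (partials_of_ev _ _ Hf x1 x2) as [_ [_ [E1 E2]]].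
  specialize (Hq (x1, x2)). unfold advect in Hq.
  replace (q (x1, x2)) with (- (g (x1, x2) + (fst (v (x1, x2)) * partial1 f (x1, x2) +
      snd (v (x1, x2)) * partial2 f (x1, x2)))) by lra.
  unfold G. rewrite ev_tscal, ev_app, ev_tscal, ev_app, !ev_tmul.
  rewrite RtoC_opp, !RtoC_plus, !RtoC_mult, E1, E2, Hg, Hv1, Hv2. ring. }
assert (E := gradient_curl_free p (G c1 d1) (G c2 d2) Hp
  (HG (fun x => fst (v x)) (fun x => fst (w x)) (partial1 p) c1 d1 Hv1 Hw1 Hm1)
  (HG (fun x => snd (v x)) (fun x => snd (w x)) (partial2 p) c2 d2 Hv2 Hw2 Hm2) K).
unfold G in E. rewrite !tdiff1_tpoly, !tdiff2_tpoly in E.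
rewrite !coef_tscal, !coef_app, !coef_tscal, !coef_app, !coef_tmul_tpoly in E.
rewrite !coef_tpoly in E;
  try easy; try (intros H; unfold d1, d2; rewrite Hb by easy; ring).
(* The interaction before symmetrization: mode [l] advects mode [m]. The factor $\det(l, m)$ is
   $l^\perp \cdot m$ from the advection, and $|m|^2 + l \cdot m = K \cdot m$ comes from the curl at
   $K = l + m$. *)
set (T := fun l m => (Zc (kdet l m * (kdot m m + kdot l m)) * (a l * a m) * indic (kadd l m) K)%C).
assert (ET : (Zc (kdot K K) * b K + Ci * csum (fun q => T (fst q) (snd q)) (list_prod S S))%C = RtoC 0).
{ fold (Zc (fst K)) in E. fold (Zc (snd K)) in E.
  assert (E' : (Zc (fst K) * (d2 K + Ci * (csum (fun q => c1 (fst q) * (RtoC (IZR (fst (snd q))) * c2 (snd q)) *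
      indic (kadd (fst q) (snd q)) K) (list_prod S S) + csum (fun q => c2 (fst q) * (RtoC (IZR (snd (snd q))) * c2 (snd q)) *
      indic (kadd (fst q) (snd q)) K) (list_prod S S)))
    + - Zc (snd K) * (d1 K + Ci * (csum (fun q => c1 (fst q) * (RtoC (IZR (fst (snd q))) * c1 (snd q)) *
      indic (kadd (fst q) (snd q)) K) (list_prod S S) + csum (fun q => c2 (fst q) * (RtoC (IZR (snd (snd q))) * c1 (snd q)) *
      indic (kadd (fst q) (snd q)) K) (list_prod S S))))%C = RtoC 0).
  { match goal with |- (?A * ?X + - ?B * ?Y)%C = _ =>
      replace (A * X + - B * Y)%C with (B * (- RtoC 1 * Y) - A * (- RtoC 1 * X))%C by ring end.
    rewrite E; ring. }
  rewrite <- E'. rewrite <- !csum_plus, !Cmult_plus_distr_l.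
  rewrite !(Cmult_assoc _ Ci), <- !csum_scal.
  match goal with |- (?x + ?y)%C = (?z + ?s1 + (?z' + ?s2))%C =>
    replace (z + s1 + (z' + s2))%C with ((z + z') + (s1 + s2))%C by ring end.
  rewrite <- csum_plus. f_equal.
  - unfold d1, d2, Zc, kdot. rewrite plus_IZR, !mult_IZR, RtoC_plus, !RtoC_mult. ring.
  - apply csum_ext; intros [l m] _; unfold T, indic; cbn [fst snd].
    destruct (keq_dec (kadd l m) K) as [<-|]; [|ring].
    unfold c1, c2, Zc, kdet, kdot, kadd; cbn [fst snd].
    rewrite !mult_IZR, !minus_IZR, !plus_IZR, !mult_IZR.
    rewrite !RtoC_mult, !RtoC_minus, !RtoC_plus, !RtoC_mult. ring. }
replace (RtoC 2) with (RtoC 1 + RtoC 1)%C by (rewrite <- RtoC_plus; f_equal; ring).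
assert (ES : csum (fun q => interaction (fst q) (snd q) * (a (fst q) * a (snd q)) *
          indic (kadd (fst q) (snd q)) K)%C (list_prod S S) =
  (csum (fun q => T (fst q) (snd q)) (list_prod S S) + csum (fun q => T (fst q) (snd q)) (list_prod S S))%C).
{ rewrite (csum_prod_swap T) at 2. rewrite <- csum_plus. apply csum_ext; intros [l m] _.
  unfold T, indic; cbn [fst snd].
  replace (kadd m l) with (kadd l m) by (unfold kadd; f_equal; ring).
  destruct (keq_dec (kadd l m) K) as [<-|]; [|ring].
  unfold interaction, Zc, kdet, kdot, kadd; cbn [fst snd].
  repeat (rewrite ?mult_IZR, ?minus_IZR, ?plus_IZR).
  repeat (rewrite ?RtoC_mult, ?RtoC_minus, ?RtoC_plus). ring. }
rewrite ES.
match goal with |- ?g = _ =>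
  replace g with ((Zc (kdot K K) * b K + Ci * csum (fun q => T (fst q) (snd q)) (list_prod S S))
   + (Zc (kdot K K) * b K + Ci * csum (fun q => T (fst q) (snd q)) (list_prod S S)))%C by ring end.
rewrite ET; ring.
Qed.

(** Conjugating every coefficient and negating every frequency gives the conjugate polynomial. It
    has the same values because [f] is real, so [coef_unique] compares coefficients. *)
Lemma real_modes_conj (S : list (Z * Z)) (c : Z * Z -> C) (f : R * R -> R) :
  NoDup S -> (forall k, ~ In k S -> c k = RtoC 0) ->
  (forall x, RtoC (f x) = ev (tpoly S c) x) ->
  forall k, c (kopp k) = Cconj (c k).
Proof.
intros HS Hc Hf k.
set (T := map (fun j => (Cconj (c j), kopp j)) S).
assert (kopp_inj : forall i j, kopp i = kopp j -> i = j).
{ intros [] [] E; unfold kopp in E; simpl in E; injection E; intros; f_equal; lia. }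
assert (E : coef (tpoly S c) (kopp k) = coef T (kopp k)).
{ apply coef_unique; intros x. rewrite <- Hf.
  transitivity (Cconj (ev (tpoly S c) x)).
  - rewrite <- Hf. unfold Cconj, RtoC; simpl; f_equal; ring.
  - unfold ev, tpoly, T; rewrite !csum_map; cbn [fst snd]. clear.
    induction S as [|j S IH]; simpl; [unfold Cconj, RtoC; simpl; f_equal; ring|].
    rewrite Cplus_conj, IH, Cmult_conj; f_equal; f_equal.
    unfold echar, Cconj, expi; simpl.
    replace (dotZ (kopp j) x) with (- dotZ j x)
      by (unfold dotZ, kopp; simpl; rewrite !opp_IZR; ring).
    now rewrite cos_neg, sin_neg. }
rewrite coef_tpoly in E; [|easy|intros; now apply Hc].
rewrite E. rewrite <- (coef_tpoly S (fun j => Cconj (c j)) k HS).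
- unfold coef, T, tpoly; rewrite !csum_map; cbn [fst snd]. apply csum_ext; intros j _.
  f_equal. unfold indic. destruct (keq_dec (kopp j) (kopp k)) as [H|H];
  destruct (keq_dec j k) as [H'|H']; try easy.
  + now apply kopp_inj in H.
  + now destruct H; subst.
- intros H; rewrite Hc by easy. unfold Cconj, RtoC; simpl; f_equal; ring.
Qed.

Definition cDerive (f : R -> C) (t : R) : C :=
  (Derive (fun s => fst (f s)) t, Derive (fun s => snd (f s)) t).

Lemma cDerive_correct (f : R -> C) (t : R) (l : C) : cderiv f t l -> cDerive f t = l.
Proof.
intros [H1 H2]; unfold cDerive. rewrite (surjective_pairing l); f_equal; now apply is_derive_unique.
Qed.

(* The coefficients are finite linear combinations of values of [v], hence
   differentiable in time without any uniformity in [x]. *)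
Lemma mode_derivatives (S : list (Z * Z)) (I : R -> Prop) (v : R * R -> R -> R)
  (c : R -> Z * Z -> C) :
  NoDup S -> (forall t, I t -> locally t I) ->
  (forall t k, I t -> ~ In k S -> c t k = RtoC 0) ->
  (forall x t, I t -> ex_derive (v x) t) ->
  (forall t x, I t -> RtoC (v x t) = ev (tpoly S (c t)) x) ->
  forall t, I t ->
    (forall k, cderiv (fun s => c s k) t (cDerive (fun s => c s k) t)) /\
    (forall x, RtoC (Derive (v x) t) = ev (tpoly S (fun k => cDerive (fun s => c s k) t)) x).
Proof.
intros HS HI Hc Hd Hv t It.
assert (D : forall k, cderiv (fun s => c s k) t (cDerive (fun s => c s k) t)).
{ intros k. destruct (sampling_coef S k) as [W HW].
  assert (E : cderiv (fun s => c s k) t (csum (fun w => fst w * RtoC (Derive (v (snd w)) t))%C W)).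
  { eapply cderiv_ext_loc.
    2:{ apply (cderiv_csum (fun w s => fst w * RtoC (v (snd w) s))%C). intros w _.
        now apply cderiv_scal, cderiv_real, Hd. }
    generalize (HI t It); apply filter_imp; intros s Is.
    rewrite <- (coef_tpoly S (c s) k HS) by (intros; now apply Hc).
    rewrite HW.
    - apply csum_ext; intros w _. now rewrite Hv.
    - intros p Hp. apply in_map_iff in Hp. now destruct Hp as [j [<- Hj]]. }
  now rewrite (cDerive_correct _ _ _ E). }
split; [exact D|]. intros x.
destruct (cderiv_real_inv (v x) t (ev (tpoly S (fun k => cDerive (fun s => c s k) t)) x)) as [_ H].
- eapply cderiv_ext_loc with (f := fun s => ev (tpoly S (c s)) x).
  + generalize (HI t It); apply filter_imp; intros s Is. now rewrite Hv.
  + unfold ev, tpoly. rewrite csum_map; cbn [fst snd].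
    eapply cderiv_ext_loc.
    2:{ apply (cderiv_csum (fun k s => c s k * echar k x)%C (fun k => cDerive (fun s => c s k) t * echar k x)%C).
        intros k _. rewrite Cmult_comm.
        eapply cderiv_ext_loc; [|apply (cderiv_scal (echar k x)), D].
        apply filter_forall; intros; ring. }
    apply filter_forall; intros s. now rewrite csum_map.
- now symmetry.
Qed.

Theorem theorem5p1 (t1 t2 : Rbar) (ht : Rbar_lt t1 t2)
    (u : R * R -> R -> R * R)
    (hu : euler_solution t1 t2 u)
    (hmean : forall t : R, in_interval t1 t2 t ->
       fourier_vec (fun x => u x t) (0%Z, 0%Z) = (RtoC 0, RtoC 0))
    (S : list (Z * Z))
    (hS : forall (k : Z * Z) (t : R), ~ In k S -> in_interval t1 t2 t ->
       fourier_vec (fun x => u x t) k = (RtoC 0, RtoC 0)) :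
  (forall (x : R * R) (s t : R),
     in_interval t1 t2 s -> in_interval t1 t2 t -> u x s = u x t) /\
  ((exists r : R, 0 < r /\
      forall (t : R) (k : Z * Z), in_interval t1 t2 t ->
        fourier_support (fun x => u x t) k -> on_circle r k) \/
   (exists a b : R, (a, b) <> (0, 0) /\
      forall (t : R) (k : Z * Z), in_interval t1 t2 t ->
        fourier_support (fun x => u x t) k -> on_line a b k)).
Proof.
destruct hu as [p hu].
set (I := in_interval t1 t2) in *.
set (S' := nodup keq_dec S).
assert (HS' : NoDup S') by apply NoDup_nodup.
set (c := fun (pr : R * R -> R) t k =>
   (fourier (fun x => pr (u x t)) k / RtoC ((2 * PI) ^ 2))%C).
assert (Hpi : RtoC ((2 * PI) ^ 2) <> RtoC 0).
{ intros E; injection E; intros E'. pose proof PI_RGT_0. nra. }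
assert (Hc0 : forall t k, fourier_vec (fun x => u x t) k = (RtoC 0, RtoC 0) ->
   c fst t k = RtoC 0 /\ c snd t k = RtoC 0).
{ intros t k E. unfold c; split;
  [change (fourier (fun x => fst (u x t)) k) with (fst (fourier_vec (fun x => u x t) k))
  |change (fourier (fun x => snd (u x t)) k) with (snd (fourier_vec (fun x => u x t) k))];
  rewrite E; cbn [fst snd]; unfold Cdiv; ring. }
assert (HcS : forall t k, I t -> ~ In k S' -> c fst t k = RtoC 0 /\ c snd t k = RtoC 0).
{ intros t k It Hk. apply Hc0, hS; [|easy]. intros H; apply Hk; now apply nodup_In. }
assert (Hcz : forall t, I t -> c fst t (0, 0)%Z = RtoC 0 /\ c snd t (0, 0)%Z = RtoC 0).
{ intros t It. now apply Hc0, hmean. }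
assert (Hcont : forall t x, I t -> continuous (fun y => u y t) x).
{ intros t x It. destruct (hu t It) as [_ [_ H]]. destruct (H x) as [H1 _].
  exact (filterdiff_continuous _ _ H1). }
assert (Hrep : forall pr : R * R -> R, (forall y, continuous pr y) ->
  (forall t k, I t -> ~ In k S' -> c pr t k = RtoC 0) ->
  forall t x, I t -> RtoC (pr (u x t)) = ev (tpoly S' (c pr t)) x).
{ intros pr Hpr Hz t x It.
  assert (Cf : forall y, continuous (fun x => pr (u x t)) y).
  { intros y. apply (continuous_comp (fun x => u x t) pr); [now apply Hcont|apply Hpr]. }
  assert (Ef := fun k => fourier_cfourier (fun x => pr (u x t)) k Cf).
  rewrite (fourier_inversion (fun x => RtoC (pr (u x t))) S').
  - unfold ev, tpoly; rewrite !csum_map; apply csum_ext; intros k _; cbn [fst snd].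
    unfold c; now rewrite Ef.
  - intros y; split; [apply Cf|apply continuous_const].
  - destruct (hu t It) as [H _]. intros x1 x2. destruct (H x1 x2) as [E1 E2].
    now rewrite E1, E2.
  - easy.
  - intros k Hk. rewrite <- Ef. specialize (Hz t k It Hk). unfold c in Hz.
    replace (fourier (fun x => pr (u x t)) k) with
      (fourier (fun x => pr (u x t)) k / RtoC ((2 * PI) ^ 2) * RtoC ((2 * PI) ^ 2))%C by (field; easy).
    rewrite Hz; ring. }
assert (Hr1 := Hrep fst (fun y => ltac:(destruct y; apply continuous_fst)) (fun t k It Hk => proj1 (HcS t k It Hk))).
assert (Hr2 := Hrep snd (fun y => ltac:(destruct y; apply continuous_snd)) (fun t k It Hk => proj2 (HcS t k It Hk))).
clear Hrep.
assert (HI : forall t, I t -> locally t I) by apply in_interval_locally.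
assert (Hslice : forall x t, I t -> ex_derive (fun s => fst (u x s)) t /\ ex_derive (fun s => snd (u x s)) t).
{ intros x t It. destruct (hu t It) as [_ [_ H]]. destruct (H x) as [_ [[l Hl] _]].
  split; eexists.
  - exact (filterdiff_comp' (K := R_AbsRing) _ fst t _ _ Hl (filterdiff_linear fst is_linear_fst)).
  - exact (filterdiff_comp' (K := R_AbsRing) _ snd t _ _ Hl (filterdiff_linear snd is_linear_snd)). }
set (d := fun (pr : R * R -> R) t k => cDerive (fun s => c pr s k) t).
assert (Hd1 := mode_derivatives S' I (fun x s => fst (u x s)) (c fst) HS' HI
  (fun t k It Hk => proj1 (HcS t k It Hk)) (fun x t It => proj1 (Hslice x t It)) Hr1).
assert (Hd2 := mode_derivatives S' I (fun x s => snd (u x s)) (c snd) HS' HI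
  (fun t k It Hk => proj2 (HcS t k It Hk)) (fun x t It => proj2 (Hslice x t It)) Hr2).
assert (Hdiv : forall t k, I t -> (Zc (fst k) * c fst t k + Zc (snd k) * c snd t k)%C = RtoC 0).
{ intros t k It. apply (divergence_free_modes S' (c fst t) (c snd t) (fun x => u x t)); try easy.
  - intros j Hj; now apply HcS.
  - intros x; now apply Hr1.
  - intros x; now apply Hr2.
  - intros x. destruct (hu t It) as [_ [_ H]]. now apply H. }
(* The component of the velocity mode along $k^\perp$. At $k = 0$ the second factor is 0, so the
   inverse of 0 does no harm. *)
set (a := fun t k => (/ Zc (kdot k k) * (Zc (fst k) * c snd t k - Zc (snd k) * c fst t k))%C).
set (b := fun t k => (/ Zc (kdot k k) * (Zc (fst k) * d snd t k - Zc (snd k) * d fst t k))%C).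
assert (Hkk : forall k, k <> (0, 0)%Z -> Zc (kdot k k) <> RtoC 0).
{ intros k Hk E. apply Zc_eq_0 in E. apply kdot_pos in Hk. lia. }
assert (Hc_a : forall t k, I t -> c fst t k = (- (Zc (snd k) * a t k))%C /\ c snd t k = (Zc (fst k) * a t k)%C).
{ intros t k It. destruct (keq_dec k (0, 0)%Z) as [->|Hk].
  (* Here the zero mean enters: $k^\perp = 0$ could not represent a nonzero mode 0. *)
  - destruct (Hcz t It) as [-> ->]. unfold Zc; simpl; split; ring.
  - specialize (Hdiv t k It). specialize (Hkk k Hk).
    assert (Ek : Zc (kdot k k) = (Zc (fst k) * Zc (fst k) + Zc (snd k) * Zc (snd k))%C).
    { unfold Zc, kdot. now rewrite plus_IZR, !mult_IZR, RtoC_plus, !RtoC_mult. }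
    unfold a. set (N := Zc (kdot k k)) in *.
    split.
    + transitivity (/ N * (N * c fst t k))%C; [field; easy|].
      rewrite Ek at 2.
      transitivity (/ N * (Zc (fst k) * (Zc (fst k) * c fst t k + Zc (snd k) * c snd t k)
        - Zc (snd k) * (Zc (fst k) * c snd t k - Zc (snd k) * c fst t k)))%C; [ring|].
      rewrite Hdiv; ring.
    + transitivity (/ N * (N * c snd t k))%C; [field; easy|].
      rewrite Ek at 2.
      transitivity (/ N * (Zc (snd k) * (Zc (fst k) * c fst t k + Zc (snd k) * c snd t k)
        + Zc (fst k) * (Zc (fst k) * c snd t k - Zc (snd k) * c fst t k)))%C; [ring|].
      rewrite Hdiv; ring. }
assert (Hab : forall t k, I t -> cderiv (fun s => a s k) t (b t k)).
{ intros t k It. unfold a, b. apply cderiv_scal. unfold Cminus.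
  apply cderiv_plus; [apply cderiv_scal; now apply Hd2|].
  destruct (cderiv_scal (- Zc (snd k))%C _ _ _ (proj1 (Hd1 t It) k)) as [H1 H2].
  eapply eq_ind; [eapply cderiv_ext_loc; [|split; [exact H1|exact H2]]|].
  - apply filter_forall; intros; ring.
  - unfold d; ring. }
(* The relation between [c] and [a] holds at all times near [t], hence passes to the derivatives. *)
assert (Hd_b : forall t k, I t -> d fst t k = (- (Zc (snd k) * b t k))%C /\ d snd t k = (Zc (fst k) * b t k)%C).
{ intros t k It. split.
  - unfold d. apply cDerive_correct.
    replace (- (Zc (snd k) * b t k))%C with (- Zc (snd k) * b t k)%C by ring.
    eapply cderiv_ext_loc; [|apply cderiv_scal, Hab, It].
    generalize (HI t It); apply filter_imp; intros s Is. rewrite (proj1 (Hc_a s k Is)); ring.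
  - unfold d. apply cDerive_correct.
    eapply cderiv_ext_loc; [|apply cderiv_scal, Hab, It].
    generalize (HI t It); apply filter_imp; intros s Is. now rewrite (proj2 (Hc_a s k Is)). }
assert (HaS : forall t k, I t -> ~ In k S' -> a t k = RtoC 0).
{ intros t k It Hk. unfold a. destruct (HcS t k It Hk) as [-> ->]. ring. }
assert (tpoly_ext : forall e f x, (forall k, e k = f k) -> ev (tpoly S' e) x = ev (tpoly S' f) x).
{ intros e f x H. unfold ev, tpoly; rewrite !csum_map; apply csum_ext; intros k _; simpl; now rewrite H. }
destruct (finite_mode_dynamics_trivial t1 t2 S' a b ht HS' Hab HaS) as [A [RA [HA Hconst]]].
(* If [a] vanishes at $-k$, both velocity components do; by conjugation they vanish at $k$ too, and
   so does [a]. *)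
- intros t k It Hk E. apply Hk.
  assert (E1 := real_modes_conj S' (c fst t) (fun x => fst (u x t)) HS'
    (fun j Hj => proj1 (HcS t j It Hj)) (fun x => Hr1 t x It) k).
  assert (E2 := real_modes_conj S' (c snd t) (fun x => snd (u x t)) HS'
    (fun j Hj => proj2 (HcS t j It Hj)) (fun x => Hr2 t x It) k).
  destruct (Hc_a t (kopp k) It) as [F1 F2]. rewrite E in F1, F2.
  unfold a. rewrite <- (Cconj_conj (c fst t k)), <- (Cconj_conj (c snd t k)), <- E1, <- E2, F1, F2.
  replace (- (Zc (snd (kopp k)) * RtoC 0))%C with (RtoC 0) by ring.
  rewrite Cmult_0_r. unfold Cconj at 1 2; simpl. rewrite Ropp_0. fold (RtoC 0). ring.
- intros t _. unfold a, Zc; simpl. ring.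
- intros t K It. destruct (hu t It) as [_ [_ H]].
  apply (stream_equation S' (a t) (b t) (fun x => u x t)
    (fun x => (Derive (fun s => fst (u x s)) t, Derive (fun s => snd (u x s)) t)) (fun x => p x t)).
  + easy.
  + intros k Hk; now apply HaS.
  + intros k Hk. apply (cderiv_unique (fun s => a s k) t); [now apply Hab|].
    eapply cderiv_ext_loc; [|apply (cderiv_const (RtoC 0))].
    generalize (HI t It); apply filter_imp; intros s Is. symmetry; now apply HaS.
  + intros x. rewrite (Hr1 t x It). exact (tpoly_ext _ _ x (fun k => proj1 (Hc_a t k It))).
  + intros x. rewrite (Hr2 t x It). exact (tpoly_ext _ _ x (fun k => proj2 (Hc_a t k It))).
  + intros x; cbn [fst]. rewrite (proj2 (Hd1 t It) x). exact (tpoly_ext _ _ x (fun k => proj1 (Hd_b t k It))).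
  + intros x; cbn [snd]. rewrite (proj2 (Hd2 t It) x). exact (tpoly_ext _ _ x (fun k => proj2 (Hd_b t k It))).
  + intros x; now apply H.
  + intros x; now apply H.
  + intros x; now apply H.
- split.
  + intros x s t Is It.
    assert (E1 : RtoC (fst (u x s)) = RtoC (fst (u x t))).
    { rewrite (Hr1 s x Is), (Hr1 t x It). apply tpoly_ext; intros k.
      now rewrite (proj1 (Hc_a s k Is)), (proj1 (Hc_a t k It)), (Hconst s t k Is It). }
    assert (E2 : RtoC (snd (u x s)) = RtoC (snd (u x t))).
    { rewrite (Hr2 s x Is), (Hr2 t x It). apply tpoly_ext; intros k.
      now rewrite (proj2 (Hc_a s k Is)), (proj2 (Hc_a t k It)), (Hconst s t k Is It). }
    injection E1; injection E2; intros. now apply injective_projections.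
  + assert (Hsupp : forall t k, I t -> fourier_support (fun x => u x t) k -> A k).
    { intros t k It Hk. apply (HA t k It). intros E. apply Hk.
      destruct (Hc_a t k It) as [F1 F2]. rewrite E, Cmult_0_r in F2. rewrite E in F1.
      assert (Z : forall z, (z / RtoC ((2 * PI) ^ 2))%C = RtoC 0 -> z = RtoC 0).
      { intros z Hz. replace z with (z / RtoC ((2 * PI) ^ 2) * RtoC ((2 * PI) ^ 2))%C by (field; easy).
        rewrite Hz; ring. }
      unfold fourier_vec. f_equal; apply Z; [|exact F2].
      eapply eq_trans; [exact F1|ring]. }
    destruct RA as [[e [He R]]|[N [HN R]]]; [right|left].
    (* The normal $e^\perp$ of the line spanned by [e], since [kdet e k] equals $e^\perp \cdot
       k$. *)
    * exists (- IZR (snd e)), (IZR (fst e)). split.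
      -- intros E; injection E; intros E1 E2. apply He. destruct e; simpl in *.
         f_equal; apply eq_IZR; lra.
      -- intros t k It Hk. unfold on_line. specialize (R k (Hsupp t k It Hk)).
         apply (f_equal IZR) in R. unfold kdet in R. rewrite minus_IZR, !mult_IZR in R. lra.
    * exists (sqrt (IZR N)). split.
      -- apply sqrt_lt_R0. now apply IZR_lt.
      -- intros t k It Hk. unfold on_circle. rewrite pow2_sqrt by (apply IZR_le; lia).
         specialize (R k (Hsupp t k It Hk)).
         apply (f_equal IZR) in R. unfold kdot in R. rewrite plus_IZR, !mult_IZR in R. lra.
Qed.
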